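(* If $G$ is a $2$-connected outerplanar graph with $\Delta(G)=\Delta\geq 5$ and girth $g(G)\geq 4$, then $\chi_{vi,1}(G)=\Delta+2$.
   Context: All graphs are finite, simple and undirected. An incidence of $G$ is a pair $(v,e)$ with $v\in V(G)$, $e\in E(G)$, $v\in e$; $I(G)$ is the set of incidences. Let $G^{1/3}$ be obtained from $G$ by replacing each edge $e=\{u,v\}$ by the path $u,(u,e),(v,e),v$. A $vi$-simultaneous proper $k$-coloring of $G$ is a map $c:V(G)\cup I(G)\to\{1,\dots,k\}$ such that any two distinct elements at distance at most $3$ in $G^{1/3}$ receive distinct colors. For a vertex $v$, $I_2(v)=\{(u,\{u,v\}) : u\in N_G(v)\}$. Such a coloring is a $(k,s)$-coloring if for every vertex $v$ at most $s$ distinct colors appear on $I_2(v)$; $\chi_{vi,s}(G)$ is the least such $k$. The girth is the length of a shortest cycle. A graph is outerplanar if it has a planar drawing with all vertices on the outer face. *)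

(* Defs.v *)
From HB Require Import structures.
From mathcomp Require Import all_boot all_order all_algebra.

Set Implicit Arguments.
Unset Strict Implicit.
Unset Printing Implicit Defensive.

Record sgraph := SGraph {
  vertex :> finType;
  adj : rel vertex;
  adj_sym : symmetric adj;
  adj_irrefl : irreflexive adj }.

Section Graph.

Variable G : sgraph.

Definition edges : {set {set G}} :=
  [set [set p.1; p.2] | p in [set p : G * G | adj p.1 p.2]].

Definition neighbours (v : G) : {set G} := [set u | adj v u].

Definition max_degree : nat := \max_(v : G) #|neighbours v|.

Definition connected_off (X : {set G}) : Prop :=
  forall u v : G, u \notin X -> v \notin X ->
    connect [rel a b | [&& adj a b, a \notin X & b \notin X]] u v.

Definition k_connected (k : nat) : Prop :=
  k < #|G| /\ forall X : {set G}, #|X| < k -> connected_off X.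

Definition is_cycle (s : seq G) : bool := (2 < size s) && ucycleb (@adj G) s.

Definition is_girth (g : nat) : Prop :=
  (exists2 s, is_cycle s & size s = g) /\
  (forall s, is_cycle s -> g <= size s).

Definition incidence : Type :=
  {i : G * {set G} | (i.2 \in edges) && (i.1 \in i.2)}.

HB.instance Definition _ := Finite.on incidence.

(* The vertices of G^{1/3}, that is V(G) together with I(G). *)
Definition vi_elt : Type := (G + incidence)%type.

HB.instance Definition _ := Finite.on vi_elt.

(* Each edge e = {u, v} of G becomes the path u, (u, e), (v, e), v. *)
Definition adj_third (x y : vi_elt) : bool :=
  match x, y with
  | inl _, inl _ => false
  | inl u, inr i | inr i, inl u => u == (val i).1
  | inr i, inr j => ((val i).2 == (val j).2) && ((val i).1 != (val j).1)
  end.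

Definition dist_third_le (d : nat) (x y : vi_elt) : Prop :=
  exists p : seq vi_elt,
    [/\ path adj_third x p, last x p = y & size p <= d].

Definition vi_coloring (k : nat) (c : vi_elt -> 'I_k) : Prop :=
  forall x y : vi_elt, x != y -> dist_third_le 3 x y -> c x != c y.

Definition I2 (v : G) : {set incidence} :=
  [set i : incidence |
     ((val i).1 \in neighbours v) && ((val i).2 == [set (val i).1; v])].

Definition vi_ks_coloring (k s : nat) (c : vi_elt -> 'I_k) : Prop :=
  vi_coloring c /\ forall v : G, #|[set c (inr i) | i in I2 v]| <= s.

Definition is_chi_vi (s k : nat) : Prop :=
  (exists c : vi_elt -> 'I_k, vi_ks_coloring s c) /\
  (forall j, (exists c : vi_elt -> 'I_j, vi_ks_coloring s c) -> k <= j).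

End Graph.

From mathcomp Require Import all_classical all_reals all_analysis.
Import Order.TTheory GRing.Theory Num.Theory.
Import numFieldNormedType.Exports.
Local Open Scope classical_set_scope.
Local Open Scope ring_scope.

Section Drawing.

Variables (R : realType) (G : sgraph).

(* [edge_arc e] is only meaningful for e in [edges G] and on [0, 1]. *)
Record drawing := Drawing {
  vertex_point : G -> R * R;
  edge_arc : {set G} -> R -> R * R;
  point_inj : injective vertex_point;
  arc_continuous : forall e, e \in edges G ->
    {within `[0, 1], continuous (edge_arc e)};
  arc_inj : forall e, e \in edges G -> {in `[0, 1] &, injective (edge_arc e)};
  arc_ends : forall e, e \in edges G ->
    [set edge_arc e 0; edge_arc e 1] = vertex_point @` [set` e];
  arc_avoids_points : forall e v (t : R), e \in edges G -> t \in `]0, 1[ ->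
    edge_arc e t <> vertex_point v;
  arcs_disjoint : forall e f (s t : R), e \in edges G -> f \in edges G -> e != f ->
    s \in `]0, 1[ -> t \in `]0, 1[ -> edge_arc e s <> edge_arc f t }.

Definition drawn_set (D : drawing) : set (R * R) :=
  range (vertex_point D) `|` \bigcup_(e in [set` edges G]) (edge_arc D e @` `[0, 1]).

Definition is_face (D : drawing) (F : set (R * R)) : Prop :=
  exists2 p, (~` drawn_set D) p &
    F = connected_component (~` drawn_set D) p.

Definition is_outer_face (D : drawing) (F : set (R * R)) : Prop :=
  is_face D F /\ ~ bounded_set F.

(* A vertex never belongs to a face, which is a subset of the complement of
   the drawing: lying on the outer face means lying on its boundary. *)
Definition outerplanar : Prop :=
  exists (D : drawing) (F : set (R * R)),
    is_outer_face D F /\ forall v : G, closure F (vertex_point D v).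

End Drawing.

(* Main.v *)
Require Import Defs.
From HB Require Import structures.
From mathcomp Require Import all_boot all_order all_algebra.
From mathcomp Require Import all_classical all_reals all_analysis.
From mathcomp Require Import ring lra zify.
From Stdlib Require Import Btauto.
Set Implicit Arguments. Unset Strict Implicit. Unset Printing Implicit Defensive.
Import Order.TTheory GRing.Theory Num.Theory.
Import numFieldNormedType.Exports.

(** A (k,1)-colouring is a colouring [b] of the square of [G] together with a
    proper colouring [a] of [G] such that [a v] avoids [b] on the closed
    neighbourhood of [v]; a vertex of maximum degree forces Delta + 2 colours.

    For the upper bound, the drawing enters only through the absence of a
    K_{2,3} minor. If p, q are joined through three disjoint connected sets
    M_0, M_1, M_2, then p, q and a point of the outer face, against one vertex
    of each M_j, give nine compact sets realising the edges of K_{3,3}, those of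
    independent edges being disjoint; the closure condition suffices because
    the last short segment from the face to a vertex v may only meet sets
    drawn through v. Replacing these sets by fine polygons contradicts the
    parity of the number of crossings of independent edges.

    Without K_{2,3} minors a longest cycle is Hamiltonian, and as [G] has no
    triangles its chords do not cross. The colouring is built by induction,
    removing the inner vertices (at least two) of a face cut off by a single
    chord xy. When that face lies inside a minimal chord that cuts off more than
    one face, x or y has degree at most 4 < Delta, and this leaves enough freedom
    to give the outermost two removed vertices distinct colours. *)

(** * Parity of crossings between polygonal paths in the plane *)

Lemma addb_xorb : addb =2 xorb. Proof. by case; case. Qed.

Ltac xor := rewrite ?addb_xorb; btauto.

Section PolygonParity.
Local Open Scope ring_scope.
Variable R : realFieldType.
Implicit Types (a b c d z p q r x y u v : R * R).

(* The order of abscissas after an infinitesimal shear, so that no genericity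
   assumption on the points is needed. *)
Definition lex p q := (p.1 < q.1) || ((p.1 == q.1) && (p.2 < q.2)).

Definition cross p q := p.1 * q.2 - p.2 * q.1.

(** Twice the signed area of the triangle abc, positive when c lies to the left of the line directed
    from a to b. *)
Definition orient a b c := cross (b - a) (c - a).

Definition affine a b (t : R) : R * R :=
  (a.1 + t * (b.1 - a.1), a.2 + t * (b.2 - a.2)).

Definition segments_disjoint a b c d :=
  forall s t : R, 0 <= s <= 1 -> 0 <= t <= 1 -> affine a b s <> affine c d t.

Lemma lexP p q : reflect (p.1 < q.1 \/ p.1 = q.1 /\ p.2 < q.2) (lex p q).
Proof.
apply: (iffP orP) => -[h|h]; [by left| |by left|].
  by right; case/andP: h => /eqP.
by right; case: h => -> ->; rewrite eqxx.
Qed.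

Lemma lex_irr p : lex p p = false.
Proof. by rewrite /lex !ltxx andbF. Qed.

Lemma lex_trans : transitive lex.
Proof.
move=> q p r /lexP h1 /lexP h2; apply/lexP.
case: h1 => [h1|[e1 h1]]; case: h2 => [h2|[e2 h2]].
- by left; lra.
- by left; lra.
- by left; lra.
- by right; split; lra.
Qed.

Lemma lex_total p q : p != q -> lex q p = ~~ lex p q.
Proof.
case: p q => [p1 p2] [q1 q2]; rewrite xpair_eqE /lex /=.
by case: (ltrgtP p1 q1) => //= _; case: (ltrgtP p2 q2).
Qed.

Lemma lex_asym p q : lex p q -> lex q p = false.
Proof. by move=> h; apply/negP => /(lex_trans h); rewrite lex_irr. Qed.

Lemma lex_subP p q : lex p q = lex 0 (q - p).
Proof. by rewrite /lex /= !subr_gt0 [0 == _]eq_sym subr_eq0 [q.1 == _]eq_sym. Qed.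

Lemma affine0 a b : affine a b 0 = a.
Proof. by rewrite /affine !mul0r !addr0; case: a. Qed.

Lemma affine1 a b : affine a b 1 = b.
Proof. by rewrite /affine !mul1r ![_ + (_ - _)]addrC !subrK; case: b. Qed.

Lemma affine_rev a b t : affine b a t = affine a b (1 - t).
Proof. by congr (_, _); ring. Qed.

(** Lexicographic half-planes are convex: for 0 < t < 1 both weights of the combination are
    positive, so a strict inequality at either point survives. *)
Lemma lex_affine a c d t : lex a c -> lex a d -> 0 <= t <= 1 ->
  lex a (affine c d t).
Proof.
case: a c d => [a1 a2] [c1 c2] [d1 d2].
move=> /lexP /= h1 /lexP /= h2 /andP[t0 t1]; apply/lexP => /=.
have E1 : c1 + t * (d1 - c1) = (1 - t) * c1 + t * d1 by ring.
have E2 : c2 + t * (d2 - c2) = (1 - t) * c2 + t * d2 by ring.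
rewrite E1 E2.
have [->|tn0] := eqVneq t 0; first by rewrite subr0 !mul1r !mul0r !addr0.
have [->|tn1] := eqVneq t 1; first by rewrite subrr !mul1r !mul0r !add0r.
have tp : 0 < t by rewrite lt_neqAle eq_sym tn0.
have tq : 0 < 1 - t by rewrite subr_gt0 lt_neqAle tn1.
have Ea1 : a1 = (1 - t) * a1 + t * a1 by ring.
have Ea2 : a2 = (1 - t) * a2 + t * a2 by ring.
rewrite [in a1 < _]Ea1 [in a1 = _]Ea1 [in a2 < _]Ea2.
case: h1 => [h1|[<- h1]]; case: h2 => [h2|[<- h2]].
- by left; rewrite ltrD // ltr_pM2l.
- by left; rewrite ltrD2r ltr_pM2l.
- by left; rewrite ltrD2l ltr_pM2l.
- by right; split=> //; rewrite ltrD // ltr_pM2l.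
Qed.

(** The reflection through the origin reverses [lex] and turns this into [lex_affine]. *)
Lemma lex_affine_r b c d t : lex c b -> lex d b -> 0 <= t <= 1 ->
  lex (affine c d t) b.
Proof.
move=> h1 h2 ht.
have := @lex_affine (- b) (- c) (- d) t.
have N x y : lex (- x) (- y) = lex y x.
  by rewrite /lex /= !ltrN2 eqr_opp [y.1 == _]eq_sym.
have -> : affine (- c) (- d) t = - affine c d t by congr (_, _); rewrite /=; ring.
by rewrite !N; apply.
Qed.

(** The parameter is read off the abscissas, or off the ordinates when the line is vertical; the two
    [lex] bounds place it in the unit interval. *)
Lemma collinear_between a b z : lex a z -> lex z b -> orient a b z = 0 ->
  exists2 s, 0 <= s <= 1 & z = affine a b s.
Proof.
case: a b z => [a1 a2] [b1 b2] [z1 z2].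
rewrite /orient /cross /affine /= => /lexP /= h1 /lexP /= h2 ho.
have [ab|ab] := ltP a1 b1.
  have hp : 0 < b1 - a1 by rewrite subr_gt0.
  have hn : b1 - a1 != 0 by rewrite gt_eqF.
  exists ((z1 - a1) / (b1 - a1)).
    by rewrite divr_ge0 ?ler_pdivrMr //=; lra.
  congr (_, _); first by rewrite divfK //; ring.
  apply: (mulfI hn).
  have -> : (b1 - a1) * (a2 + (z1 - a1) / (b1 - a1) * (b2 - a2)) =
     (b1 - a1) * a2 + ((z1 - a1) / (b1 - a1) * (b1 - a1)) * (b2 - a2) by ring.
  by rewrite divfK //; lra.
have ez : z1 = a1 by lra.
have eb : b1 = a1 by lra.
have hp : 0 < b2 - a2 by lra.
have hn : b2 - a2 != 0 by rewrite gt_eqF.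
exists ((z2 - a2) / (b2 - a2)).
  by rewrite divr_ge0 ?ler_pdivrMr //=; lra.
by congr (_, _); rewrite ?divfK // ?ez ?eb; ring.
Qed.

(** Two vectors of the half-plane [lex 0] enclose less than a straight angle, so the sign of [cross]
    orders them by slope. The proof rests on the vector identity C q = A r + B p. *)
Lemma cross_trans p q r : lex 0 p -> lex 0 q -> lex 0 r ->
  0 < cross q p -> 0 < cross r q -> 0 < cross r p.
Proof.
case: p q r => [p1 p2] [q1 q2] [r1 r2]; rewrite /cross /=.
move=> /lexP /= hp /lexP /= hq /lexP /= hr.
set A := q1 * p2 - q2 * p1; set B := r1 * q2 - r2 * q1.
set C := r1 * p2 - r2 * p1 => A0 B0; rewrite ltNge; apply/negP => C0.
have E1 : C * q1 = A * r1 + B * p1 by rewrite /A /B /C; ring.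
have E2 : C * q2 = A * r2 + B * p2 by rewrite /A /B /C; ring.
have q10 : 0 <= q1 by lra.
have L1 : C * q1 <= 0 by rewrite mulr_le0_ge0.
have r10 : 0 <= r1 by lra.
have p10 : 0 <= p1 by lra.
have M1 : 0 <= A * r1 by rewrite mulr_ge0 // ltW.
have M2 : 0 <= B * p1 by rewrite mulr_ge0 // ltW.
have Z1 : r1 = 0.
  by apply: (mulfI (lt0r_neq0 A0)); rewrite mulr0; lra.
have Z2 : p1 = 0.
  by apply: (mulfI (lt0r_neq0 B0)); rewrite mulr0; lra.
have p20 : 0 < p2 by lra.
have : q1 = 0 \/ 0 < q1 by lra.
case=> hq1; first by move: A0; rewrite /A hq1 Z2; lra.
have : C = 0 by rewrite /C Z1 Z2; ring.
have r20 : 0 < r2 by lra.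
have N1 : 0 < A * r2 by rewrite mulr_gt0.
have N2 : 0 < B * p2 by rewrite mulr_gt0.
by move=> C00; move: E2; rewrite C00 mul0r; lra.
Qed.

(** Only the disjunct that matches the [lex] order of the endpoints can hold, so the value does not
    depend on the direction of the segment. *)
Definition above c a b :=
  [&& lex a c, lex c b & 0 < orient a b c] ||
  [&& lex b c, lex c a & 0 < orient b a c].

(* The boundary of the region above [a, b] consists of this segment and of the
   upward rays from a and b; counting modulo 2 how often [c, d] crosses it
   expresses the crossings of the two segments through their endpoints. *)
Definition crossing a b c d :=
  above c a b (+) above d a b (+) (above a c d (+) above b c d) (+)
  (lex c a (+) lex d a (+) (lex c b (+) lex d b)).

Lemma above_sym c a b : above c b a = above c a b.
Proof. by rewrite /above orbC. Qed.

Lemma crossing_symr a b c d : crossing a b d c = crossing a b c d.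
Proof.
rewrite /crossing !(above_sym _ c d) (addbC (above d a b)) (addbC (lex d a)).
by rewrite (addbC (lex d b)).
Qed.

Lemma crossing_syml a b c d : crossing b a c d = crossing a b c d.
Proof.
rewrite /crossing !(above_sym _ a b) (addbC (above b c d)).
by rewrite (addbC (lex c b (+) _)).
Qed.

Lemma segments_disjoint_symr a b c d :
  segments_disjoint a b c d -> segments_disjoint a b d c.
Proof. by move=> h s t hs ht; rewrite (affine_rev c d); apply: h => //; lra. Qed.

Lemma segments_disjoint_syml a b c d :
  segments_disjoint a b c d -> segments_disjoint b a c d.
Proof. by move=> h s t hs ht; rewrite (affine_rev a b); apply: h => //; lra. Qed.

Lemma segments_disjoint_sym a b c d :
  segments_disjoint a b c d -> segments_disjoint c d a b.
Proof. by move=> h s t hs ht /esym; apply: h. Qed.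

Lemma segments_disjoint_neq a b c d :
  segments_disjoint a b c d -> [/\ a != c, a != d, b != c & b != d].
Proof.
have h0 : 0 <= (0 : R) <= 1 by lra.
have h1 : 0 <= (1 : R) <= 1 by lra.
move=> h; split; apply/eqP => E.
- by apply: (h 0 0) => //; rewrite !affine0.
- by apply: (h 0 1) => //; rewrite affine0 affine1.
- by apply: (h 1 0) => //; rewrite affine0 affine1.
- by apply: (h 1 1) => //; rewrite !affine1.
Qed.

(** Exchanging the segments reverses four comparisons of endpoints, and four negations cancel modulo
    2. *)
Lemma crossing_sym a b c d : segments_disjoint a b c d ->
  crossing c d a b = crossing a b c d.
Proof.
move=> /segments_disjoint_neq[ac ad bc bd]; rewrite /crossing.
rewrite !(@lex_total c) ?(@lex_total d) 1?eq_sym //.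
by xor.
Qed.

(** The steps p, q, r lead through four points in [lex] order. Turning twice in the same direction
    puts them in convex position, and the two segments are the diagonals. *)
Lemma interleaved_meet p q r : lex 0 p -> lex 0 q -> lex 0 r ->
  0 < cross q p * cross r q ->
  exists s t, [/\ 0 <= s <= 1, 0 <= t <= 1 &
    forall a, affine a (a + p + q) s = affine (a + p) (a + p + q + r) t].
Proof.
move=> hp hq hr hs.
have : exists w : R, [/\ 0 < cross q p * w, 0 < cross r q * w, 0 < cross r p * w &
    w * (cross q p + cross r q + cross r p) = 1].
  have [q0|q0|q0] := ltrgtP (cross q p) 0; last by rewrite q0 mul0r ltxx in hs.
  - have r0 : cross r q < 0 by move: hs; rewrite nmulr_rgt0.
    have N x y : cross x y = - cross y x by rewrite /cross; ring.
    have c0 : cross r p < 0.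
      by rewrite N oppr_lt0; apply: (cross_trans hr hq hp); rewrite N oppr_gt0.
    have S0 : cross q p + cross r q + cross r p < 0 by lra.
    by exists (cross q p + cross r q + cross r p)^-1; rewrite mulVf ?lt_eqF // !nmulr_rgt0 ?invr_lt0.
  - have r0 : 0 < cross r q by move: hs; rewrite pmulr_rgt0.
    have c0 := cross_trans hp hq hr q0 r0.
    have S0 : 0 < cross q p + cross r q + cross r p by lra.
    by exists (cross q p + cross r q + cross r p)^-1; rewrite mulVf ?gt_eqF // !pmulr_rgt0 ?invr_gt0.
(* Cramer's rule: the sum of the three cross products is the determinant of the linear system for s
   and t, and [w] is its inverse. *)
case=> w [w1 w2 w3 w4]; exists (1 - cross r q * w), (cross q p * w).
split; [by lra|by lra|move=> a].
have K1 : q.1 = w * (cross q p + cross r q + cross r p) * q.1 by rewrite w4 mul1r.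
have K2 : q.2 = w * (cross q p + cross r q + cross r p) * q.2 by rewrite w4 mul1r.
congr (_, _); apply/eqP; rewrite -subr_eq0; apply/eqP.
  transitivity (q.1 - w * (cross q p + cross r q + cross r p) * q.1); last by rewrite -K1 subrr.
  by rewrite /cross /=; ring.
transitivity (q.2 - w * (cross q p + cross r q + cross r p) * q.2); last by rewrite -K2 subrr.
by rewrite /cross /=; ring.
Qed.

Lemma above_refl c a : above c a a = false.
Proof. by rewrite /above orbb; case: (boolP (lex a c)) => // /lex_asym ->. Qed.

Lemma above_lt c a b : lex a b -> above c a b = [&& lex a c, lex c b & 0 < orient a b c].
Proof.
move=> ab; rewrite /above orbC; case: (boolP (lex b c)) => //= bc.
by rewrite (lex_asym (lex_trans ab bc)).
Qed.

(** By symmetry a comes first in [lex] order. The ranges of the two segments are then separated,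
    nested or interleaved; in the last two cases an odd value would force a common point. *)
Lemma disjoint_crossing a b c d : segments_disjoint a b c d -> crossing a b c d = false.
Proof.
have [->|nab] := eqVneq a b; first by rewrite /crossing !above_refl !addbb.
have [->|ncd] := eqVneq c d; first by rewrite /crossing !above_refl !addbb.
wlog ab : a b nab / lex a b => [H h|].
  case: (boolP (lex a b)) => [l|]; first exact: H.
  rewrite -lex_total // -crossing_syml => l; apply: H => //; first by rewrite eq_sym.
  exact: segments_disjoint_syml.
wlog cd : c d ncd / lex c d => [H h|].
  case: (boolP (lex c d)) => [l|]; first exact: H.
  rewrite -lex_total // -crossing_symr => l; apply: H => //; first by rewrite eq_sym.
  exact: segments_disjoint_symr.
wlog ac : a b c d nab ncd ab cd / lex a c => [H h|h].
  case: (boolP (lex a c)) => [l|]; first exact: H.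
  have [ac _ _ _] := segments_disjoint_neq h.
  rewrite -lex_total // -(crossing_sym h) => l; apply: H => //.
  exact: segments_disjoint_sym.
have [_ ad bc bd] := segments_disjoint_neq h.
have ad' : lex a d := lex_trans ac cd.
rewrite /crossing !above_lt // (lex_asym ac) (lex_asym ad') ac ad' /=.
case: (boolP (lex c b)) => cb; last first.
  have bc' : lex b c by rewrite lex_total // eq_sym.
  have bd' := lex_trans bc' cd.
  by rewrite (lex_asym bd').
case: (boolP (lex d b)) => db /=.
  rewrite (lex_asym db) /= addbF; apply/negbTE; apply/negP => hx.
  have hy : orient a b c * orient a b d <= 0.
    move: hx; case: (ltP 0 (orient a b c)) => h1; case: (ltP 0 (orient a b d)) => h2 //= _.
      by rewrite pmulr_rle0.
    by rewrite pmulr_lle0.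
  have hn : orient a b c - orient a b d != 0.
    by apply/eqP => /eqP; rewrite subr_eq0 => /eqP E; rewrite E addbb in hx.
  (* The function [orient a b] is affine along the segment from c to d, and [t] is its zero. *)
  pose t := orient a b c / (orient a b c - orient a b d).
  have ht : 0 <= t <= 1.
    rewrite /t; move: hn hy; set u := orient a b c; set v := orient a b d => hn hy.
    have [l|l|l] := ltrgtP u v; last by rewrite l subrr eqxx in hn.
      have u0 : u <= 0 by rewrite leNgt; apply/negP => u0; have := mulr_gt0 u0 (lt_trans u0 l); lra.
      have v0 : 0 <= v.
        rewrite leNgt; apply/negP => v0; have /lt_geF : 0 < u * v by rewrite nmulr_lgt0 //; lra.
        by rewrite hy.
      have -> : u / (u - v) = - u / (v - u) by rewrite -[u - v]opprB invrN mulrN mulNr.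
      by apply/andP; split; [apply: divr_ge0|rewrite ler_pdivrMr ?mul1r]; lra.
    have v0 : v <= 0 by rewrite leNgt; apply/negP => v0; have := mulr_gt0 v0 (lt_trans v0 l); lra.
    have u0 : 0 <= u.
      rewrite leNgt; apply/negP => u0; have /lt_geF : 0 < u * v by rewrite nmulr_lgt0 //; lra.
      by rewrite hy.
    by apply/andP; split; [apply: divr_ge0|rewrite ler_pdivrMr ?mul1r]; lra.
  have : orient a b (affine c d t) = 0.
    have -> : orient a b (affine c d t) =
       orient a b c - t * (orient a b c - orient a b d) by rewrite /orient /cross /=; ring.
    by rewrite divfK // subrr.
  move=> /(collinear_between (lex_affine ac ad' ht) (lex_affine_r cb db ht))[s hs E].
  by apply: (h s t) => //; rewrite E.
have bd' : lex b d by rewrite lex_total // eq_sym.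
rewrite bd' /= !addbF.
have p0 : lex 0 (c - a) by rewrite -lex_subP.
have q0 : lex 0 (b - c) by rewrite -lex_subP.
have r0 : lex 0 (d - b) by rewrite -lex_subP.
have E1 : orient a b c = cross (b - c) (c - a) by rewrite /orient /cross /=; ring.
have E2 : orient c d b = cross (d - b) (b - c) by rewrite /orient /cross /=; ring.
have n1 : orient a b c != 0.
  apply/eqP => /(collinear_between ac cb)[s hs E].
  by apply: (h s 0) => //; rewrite ?lexx ?ler01 ?affine0.
have n2 : orient c d b != 0.
  apply/eqP => /(collinear_between cb bd')[s hs E].
  by apply: (h 1 s) => //; rewrite ?lexx ?ler01 ?affine1.
(* Equal signs would put a, c, b, d in convex position with the two segments as diagonals. *)
have hm : ~~ (0 < orient a b c * orient c d b).
  apply/negP; rewrite E1 E2 => /(interleaved_meet p0 q0 r0)[s [t [hs ht /(_ a)]]].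
  rewrite ![a + (_ - _)]addrC !subrK ![c + _]addrC !subrK ![b + _]addrC !subrK.
  exact: h.
move: hm n1 n2; rewrite -leNgt.
case: ltrgtP => //= h1 + _; case: ltrgtP => //= h2 + _.
- by rewrite leNgt pmulr_rgt0 // h2.
- by rewrite leNgt nmulr_rgt0 // h2.
Qed.

Fixpoint above_path c x (s : seq (R * R)) :=
  if s is y :: s' then above c x y (+) above_path c y s' else false.

Fixpoint segment_avoids a b x (s : seq (R * R)) : Prop :=
  if s is y :: s' then segments_disjoint a b x y /\ segment_avoids a b y s' else True.

Fixpoint paths_disjoint x (s : seq (R * R)) y (t : seq (R * R)) : Prop :=
  if s is x' :: s' then segment_avoids x x' y t /\ paths_disjoint x' s' y t else True.

(** In the sum of [disjoint_crossing] over the edges of the path, the terms at inner points occur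
    twice and cancel. *)
Lemma segment_path_parity a b x s : segment_avoids a b x s ->
  above x a b (+) above (last x s) a b (+) (above_path a x s (+) above_path b x s) (+)
  (lex x a (+) lex (last x s) a (+) (lex x b (+) lex (last x s) b)) = false.
Proof.
elim: s x => [|y s IH] x /=; first by rewrite !addbb.
case=> /disjoint_crossing h1 /IH h2; rewrite /crossing in h1.
by apply: etrans (congr2 addb h1 h2); xor.
Qed.

Lemma path_path_parity x s y t : paths_disjoint x s y t ->
  above_path y x s (+) above_path (last y t) x s (+)
  (above_path x y t (+) above_path (last x s) y t) (+)
  (lex y x (+) lex (last y t) x (+) (lex y (last x s) (+) lex (last y t) (last x s))) = false.
Proof.
elim: s x => [|x' s IH] x /=; first by rewrite !addbb.
case=> /segment_path_parity h1 /IH h2.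
by apply: etrans (congr2 addb h1 h2); xor.
Qed.

(* Summed over the 18 pairs of independent edges of K_{3,3}, all terms of
   [path_path_parity] cancel modulo 2 except for an odd constant, which comes
   from the antisymmetry of [lex]. *)
Lemma polygonal_K33 (u w : nat -> R * R) (s : nat -> nat -> seq (R * R)) :
  (forall i j, i < 3 -> j < 3 -> last (u i) (s i j) = w j)%N ->
  (forall j l, j < 3 -> l < 3 -> j != l -> w j != w l)%N ->
  (forall i j, i < 3 -> j < 3 -> u i != w j)%N ->
  ~ (forall i j k l, i < 3 -> j < 3 -> k < 3 -> l < 3 -> i != k -> j != l ->
     paths_disjoint (u i) (s i j) (u k) (s k l))%N.
Proof.
move=> sw ww uw D.
(* Every comparison is brought to one direction, from a [w] to a [u] and from the smaller to the
   larger index among the [w], so that equal terms cancel and only the negations are left to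
   count. *)
have T i j k l : [&& i < 3, j < 3, k < 3 & l < 3]%N -> (i != k) && (j != l) ->
  above_path (u k) (u i) (s i j) (+) above_path (w l) (u i) (s i j) (+)
  (above_path (u i) (u k) (s k l) (+) above_path (w j) (u k) (s k l)) (+)
  (lex (u k) (u i) (+) lex (w l) (u i) (+) (~~ lex (w j) (u k) (+)
   (if (l < j)%N then lex (w l) (w j) else ~~ lex (w j) (w l)))) = false.
  move=> /and4P[i3 j3 k3 l3] /andP[ik jl].
  have := path_path_parity (D i j k l i3 j3 k3 l3 ik jl); rewrite !sw //.
  rewrite (@lex_total (w j) (u k)) 1?eq_sym ?uw //.
  by case: ifP => // _; rewrite (@lex_total (w j) (w l)) ?ww.
have X (b c : bool) : b = false -> c = false -> b (+) c = false by move=> -> ->.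
have : true = false; last by [].
apply: etrans (X _ _ (X _ _
  (X _ _ (X _ _ (X _ _ (T 0 0 1 1 isT isT) (T 0 1 1 0 isT isT))
    (X _ _ (T 0 0 1 2 isT isT) (T 0 2 1 0 isT isT))) (X _ _ (T 0 1 1 2 isT isT) (T 0 2 1 1 isT isT)))
  (X _ _ (X _ _ (X _ _ (T 0 0 2 1 isT isT) (T 0 1 2 0 isT isT))
    (X _ _ (T 0 0 2 2 isT isT) (T 0 2 2 0 isT isT))) (X _ _ (T 0 1 2 2 isT isT) (T 0 2 2 1 isT isT))))
  (X _ _ (X _ _ (X _ _ (T 1 0 2 1 isT isT) (T 1 1 2 0 isT isT))
    (X _ _ (T 1 0 2 2 isT isT) (T 1 2 2 0 isT isT))) (X _ _ (T 1 1 2 2 isT isT) (T 1 2 2 1 isT isT)))) => /=.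
by xor.
Qed.
End PolygonParity.

(** * Fine chains and the K_{3,3} obstruction for compact sets *)

Section Chains.
Local Open Scope classical_set_scope.
Local Open Scope ring_scope.
Variable R : realType.
Implicit Types (x y z : R * R) (K L : set (R * R)) (e d : R).

Fixpoint chain K e x (s : seq (R * R)) : Prop :=
  if s is y :: s' then [/\ K x, ball x e y & chain K e y s'] else K x.

(** A weak replacement for arcs in K: the points of each chain lie in K, while the segments between
    them may leave it. *)
Definition linked K x y :=
  forall e, 0 < e -> exists2 s, chain K e x s & last x s = y.

Lemma chain_cat K e x s t :
  chain K e x s -> chain K e (last x s) t -> chain K e x (s ++ t).
Proof. by elim: s x => [|y s IH] x //= [Kx xy /IH h] /h. Qed.

Lemma chain_sub K L e x s : K `<=` L -> chain K e x s -> chain L e x s.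
Proof.
move=> KL; elim: s x => [|y s IH] x /=; first exact: KL.
by case=> /KL ? ? /IH.
Qed.

Lemma linked_sub K L x y : K `<=` L -> linked K x y -> linked L x y.
Proof. by move=> KL h e /h[s /(chain_sub KL)]; exists s. Qed.

Lemma linked_trans K x y z : linked K x y -> linked K y z -> linked K x z.
Proof.
move=> h1 h2 e e0; have [s cs ls] := h1 e e0; have [t ct lt] := h2 e e0.
exists (s ++ t); last by rewrite last_cat ls.
by apply: chain_cat; rewrite ?ls.
Qed.

Lemma linked_refl K x : K x -> linked K x x.
Proof. by move=> Kx e _; exists [::]. Qed.

Lemma linked_ends K x y : linked K x y -> K x /\ K y.
Proof.
move=> /(_ 1 ltr01)[s + <-]; elim: s x => [|z s IH] x //=.
by case=> Kx _ /IH[].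
Qed.

(** The points reached from x by chains of step e form a subset that is open and closed in K. *)
Lemma connected_linked K x y : connected K -> K x -> K y -> linked K x y.
Proof.
move=> cK Kx Ky e e0.
pose B := [set z | exists2 s, chain K e x s & last x s = z].
have BK : B `<=` K.
  move=> z [s + <-]; elim: s (x) => [|t s IH] a //=; by case=> _ _ /IH.
have step z w : B z -> K w -> ball z e w -> B w.
  move=> [s cs ls] Kw zw; exists (rcons s w); last by rewrite last_rcons.
  by rewrite -cats1; apply: chain_cat; rewrite //= ls; split => //; apply: BK; exists s.
suff E : B = K by have : B y by rewrite E.
apply: cK.
- by exists x, [::].
- exists (\bigcup_(z in B) (ball z e)°).
    by apply: bigcup_open => z _; exact: open_interior.
  apply/seteqP; split=> [z Bz|w [Kw [z Bz /interior_subset zw]]].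
    by split; [exact: BK|exists z => //; exact: nbhsx_ballx].
  exact: step zw.
- exists (~` \bigcup_(z in K `\` B) (ball z e)°).
    by apply: open_closedC; apply: bigcup_open => z _; exact: open_interior.
  apply/seteqP; split=> [w Bw|w [Kw nw]].
    split; first exact: BK.
    move=> [z [Kz nBz] /interior_subset zw]; apply: nBz.
    by apply: step Bw Kz _; exact: ball_sym.
  by apply: contrapT => nBw; apply: nw; exists w => //; exact: nbhsx_ballx.
Qed.

(** Each point of K has a ball that misses L, and compactness makes the radius uniform. The doubled
    radius leaves room for two segments that each stray less than d from their set. *)
Lemma compact_separated K L : compact K -> closed L -> K `&` L = set0 ->
  \forall d \near 0^'+, forall x, K x -> forall y, L y -> ~ ball x (d + d) y.
Proof.
move=> cK cL KL0.
apply: (compact_near_coveringP K).1 => // x Kx.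
have nL : (~` L) x by move=> Lx; rewrite -[False]/(set0 x) -KL0.
have : nbhs x (~` L) by apply: open_nbhs_nbhs; split=> //; exact: closed_openC.
move=> /nbhs_ballP[e /= e0 eL].
have e2 : 0 < e / 2 by rewrite divr_gt0.
have e4 : 0 < e / 4 by rewrite divr_gt0.
exists (ball x (e / 2), [set d | 0 < d < e / 4]).
  split=> /=; first exact: nbhsx_ballx.
  near=> d; apply/andP; split=> //; near: d; exact: nbhs_right_lt.
move=> [x' d] /= [xx' /andP[d0 de]] y Ly x'y; apply: (eL y) => //.
rewrite (splitr e); apply: (ball_triangle xx'); apply: le_ball x'y.
by lra.
Unshelve. all: by end_near. Qed.

Lemma affine_ball x y e t : ball x e y -> 0 <= t <= 1 -> ball x e (affine x y t).
Proof.
move=> [] /=; rewrite /ball /= => h1 h2 /andP[t0 t1].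
have H (a b : R) : `|a - b| < e -> `|a - (a + t * (b - a))| < e.
  move=> ab; have -> : a - (a + t * (b - a)) = t * (a - b) by ring.
  rewrite normrM ger0_norm //; apply: le_lt_trans ab.
  by rewrite ler_piMl.
by split; rewrite /= /ball /=; exact: H.
Qed.

Lemma chain_segment_disjoint K L d x x' y y' :
  (forall x, K x -> forall y, L y -> ~ ball x (d + d) y) ->
  K x -> L y -> ball x d x' -> ball y d y' -> segments_disjoint x x' y y'.
Proof.
move=> sep Kx Ly xx' yy' s t hs ht E.
apply: (sep x Kx y Ly); apply: (ball_triangle (affine_ball xx' hs)).
by rewrite E; apply: ball_sym; exact: affine_ball.
Qed.

Lemma chain_paths_disjoint K L d x s y t :
  (forall x, K x -> forall y, L y -> ~ ball x (d + d) y) ->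
  chain K d x s -> chain L d y t -> paths_disjoint x s y t.
Proof.
move=> sep; elim: s x => [|x' s IH] x //= [Kx xx' cs] ct; split; last exact: IH.
elim: t y ct {IH} => [|y' t IH] y //= [Ly yy' ct].
by split; [exact: (chain_segment_disjoint sep)|exact: IH].
Qed.

(** Chains whose step is small against the distances between the sets of independent edges become
    polygons to which [polygonal_K33] applies. *)
Lemma topological_K33 (u w : nat -> R * R) (K : nat -> nat -> set (R * R)) :
  (forall i j, i < 3 -> j < 3 -> compact (K i j))%N ->
  (forall i j, i < 3 -> j < 3 -> linked (K i j) (u i) (w j))%N ->
  ~ (forall i j k l, i < 3 -> j < 3 -> k < 3 -> l < 3 -> i != k -> j != l ->
     K i j `&` K k l = set0)%N.
Proof.
move=> cK lK D.
have disj i j k l x : (i < 3)%N -> (j < 3)%N -> (k < 3)%N -> (l < 3)%N ->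
    i != k -> j != l -> K i j x -> K k l x -> False.
  by move=> i3 j3 k3 l3 ik jl h1 h2; rewrite -[False]/(set0 x) -(D i j k l).
have other (i : nat) : exists2 k, (k < 3)%N & i != k.
  by case: i => [|i]; [exists 1%N|exists 0%N].
have Ku i j : (i < 3)%N -> (j < 3)%N -> K i j (u i).
  by move=> i3 j3; case: (linked_ends (lK i j i3 j3)).
have Kw i j : (i < 3)%N -> (j < 3)%N -> K i j (w j).
  by move=> i3 j3; case: (linked_ends (lK i j i3 j3)).
(* Ordinal indices make the pairs finitely many, so a single d serves them all. *)
have : \forall d \near 0^'+, forall i j k l : 'I_3, i != k -> j != l ->
    forall x, K i j x -> forall y, K k l y -> ~ ball x (d + d) y.
  do 4!(apply: filter_forall => ?); do 2!(apply: filter_imply => ?).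
  apply: compact_separated; [exact: cK| |exact: D].
  by apply: compact_closed; [exact: norm_hausdorff|exact: cK].
move=> sep.
have [d [d0 {}sep]] := filter_ex (filterI (nbhs_right_gt (0 : R)) sep).
have : forall ij : nat * nat, exists s, (ij.1 < 3 -> ij.2 < 3 ->
    chain (K ij.1 ij.2) d (u ij.1) s /\ last (u ij.1) s = w ij.2)%N.
  case=> i j /=; case: (ltnP i 3) => i3; last by exists [::].
  case: (ltnP j 3) => j3; last by exists [::].
  by have [s cs ls] := lK i j i3 j3 d d0; exists s.
move=> /choice[s hs].
apply: (@polygonal_K33 R u w (fun i j => s (i, j))).
- by move=> i j i3 j3; case: (hs (i, j)).
- move=> j l j3 l3 jl; apply/eqP => E.
  by apply: (disj 0%N j 1%N l (w j)) => //; [exact: Kw|rewrite E; exact: Kw].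
- move=> i j i3 j3; apply/eqP => E; have [k k3 ik] := other i; have [l l3 jl] := other j.
  apply: (disj i l k j (u i)) => //; rewrite 1?eq_sym //; first exact: Ku.
  by rewrite E; exact: Kw.
move=> i j k l i3 j3 k3 l3 ik jl.
have [/= c1 _] := hs (i, j) i3 j3; have [/= c2 _] := hs (k, l) k3 l3.
apply: (chain_paths_disjoint _ c1 c2).
exact: (sep (Ordinal i3) (Ordinal j3) (Ordinal k3) (Ordinal l3)).
Qed.

Definition segment_set x y : set (R * R) := affine x y @` `[0, 1].

Lemma affine_continuous x y : continuous (affine x y).
Proof.
move=> t.
have lin (a b : R) : (fun t => a + t * b) z @[z --> t] --> a + t * b.
  apply: cvgD; first exact: cvg_cst.
  by apply: cvgMr_tmp; exact: cvg_id.
by have h := cvg_pair (lin x.1 (y.1 - x.1)) (lin x.2 (y.2 - x.2)) => A hA; exact: h.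
Qed.

Lemma segment_set_compact x y : compact (segment_set x y).
Proof.
apply: continuous_compact; last exact: segment_compact.
exact/continuous_subspaceT/affine_continuous.
Qed.

Lemma segment_set_linked x y : linked (segment_set x y) x y.
Proof.
apply: connected_linked.
- apply: connected_continuous_connected; first exact: segment_connected.
  exact/continuous_subspaceT/affine_continuous.
- by exists 0; rewrite ?affine0 //= in_itv /= lexx ler01.
- by exists 1; rewrite ?affine1 //= in_itv /= lexx ler01.
Qed.

Lemma segment_set_ball x y e : ball x e y -> segment_set x y `<=` ball x e.
Proof. by move=> xy _ [t + <-]; rewrite /= in_itv /= => ht; exact: affine_ball. Qed.

Lemma linked_sym K x y : linked K x y -> linked K y x.
Proof.
move=> h e e0; have [s + <-] := h e e0.
elim: s x {h} => [|z s IH] x /=; first by exists [::].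
case=> Kx xz cs; have [t ct lt] := IH _ cs; exists (rcons t x); last by rewrite last_rcons.
rewrite -cats1; apply: chain_cat => //=; rewrite lt; split=> //; last exact: ball_sym.
by case: (s) cs => [|? ?] //= [].
Qed.

(** The points that compact subsets of U link to x form a set open and closed relative to F, because
    a step inside a ball contained in U costs one more segment. *)
Lemma open_connected_linked (U F : set (R * R)) x y : open U -> connected F ->
  F `<=` U -> F x -> F y -> exists K, [/\ compact K, K `<=` U & linked K x y].
Proof.
move=> oU cF FU Fx Fy.
pose reach := [set z | exists K, [/\ compact K, K `<=` U & linked K x z]].
have step a b e : ball a e `<=` U -> ball a e b -> reach a -> reach b.
  move=> aU ab [K [cK KU lK]]; exists (K `|` segment_set a b); split.
  - by apply: compactU => //; exact: segment_set_compact.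
  - by move=> z [/KU//|/(segment_set_ball ab)/aU].
  - apply: (@linked_trans _ _ a).
      by apply: linked_sub lK; exact: subsetUl.
    by apply: (linked_sub _ (@segment_set_linked a b)); exact: subsetUr.
have step' a b e : ball a e `<=` U -> ball a e b -> reach b -> reach a.
  move=> aU ab [K [cK KU lK]]; exists (K `|` segment_set a b); split.
  - by apply: compactU => //; exact: segment_set_compact.
  - by move=> z [/KU//|/(segment_set_ball ab)/aU].
  - apply: (@linked_trans _ _ b).
      by apply: linked_sub lK; exact: subsetUl.
    apply: linked_sym.
    by apply: (linked_sub _ (@segment_set_linked a b)); exact: subsetUr.
have loc a : U a -> exists2 e, 0 < e & ball a e `<=` U.
  move=> Ua; have : nbhs a U by apply: open_nbhs_nbhs.
  by move=> /nbhs_ballP[e /= e0 h]; exists e.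
suff E : F `&` reach = F by have [] : (F `&` reach) y by rewrite E.
apply: cF.
- exists x; split=> //; exists [set x]; split; first exact: compact_set1.
    by move=> _ ->; exact: FU.
  exact: linked_refl.
- exists (U `&` reach); last by rewrite setIA (setIidl FU).
  rewrite openE => a [Ua ra]; have [e e0 eU] := loc a Ua.
  by apply/nbhs_ballP; exists e => //= b ab; split; [exact: eU|exact: step ab ra].
- exists (~` (U `&` ~` reach)).
    apply: open_closedC; rewrite openE => a [Ua ra]; have [e e0 eU] := loc a Ua.
    apply/nbhs_ballP; exists e => //= b ab; split; first exact: eU.
    by move=> rb; apply: ra; exact: step' ab rb.
  apply/seteqP; split=> z [Fz rz]; split=> //; first by move=> [].
  by apply: contrapT => nr; apply: rz; split=> //; exact: FU.
Qed.

End Chains.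

(** * Drawings of subgraphs and the exclusion of K_{2,3} minors *)

Lemma bigsetU_memE (T : Type) (I : finType) (P : pred I) (F : I -> set T) x :
  (\big[classical_sets.setU/classical_sets.set0]_(i | P i) F i) x <-> exists2 i, P i & F i x.
Proof.
split=> [|[i Pi Fi]]; last by rewrite (bigD1 i) //; left.
elim/big_rec: _ => [//|i A Pi IH [Fi|/IH//]].
by exists i.
Qed.

Definition connected_in (G : sgraph) (S : {set G}) :=
  forall u v, u \in S -> v \in S ->
    connect [rel a b | [&& adj a b, a \in S & b \in S]] u v.

Section DrawnSubgraphs.
Local Open Scope classical_set_scope.
Local Open Scope ring_scope.
Variables (R : realType) (G : sgraph) (D : drawing R G).
Implicit Types (S T : {set G}) (e : {set G}).

Definition arc_image e : set (R * R) := edge_arc D e @` `[0, 1].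

(** The drawing of the subgraph induced by S, as a closed set. *)
Definition drawn S : set (R * R) :=
  (\big[setU/set0]_(v | v \in S) [set vertex_point D v]) `|`
  (\big[setU/set0]_(e | (e \in edges G) && (e \subset S)) arc_image e).

Lemma drawn_compact S : compact (drawn S).
Proof.
apply: compactU; [apply: bigsetU_compact => v _|apply: bigsetU_compact => e /andP[eG _]].
  exact: compact_set1.
apply: continuous_compact; last exact: segment_compact.
exact: arc_continuous.
Qed.

Lemma drawn_closed S : closed (drawn S).
Proof. by apply: compact_closed; [exact: norm_hausdorff|exact: drawn_compact]. Qed.

Lemma drawnT : drawn finset.setT = drawn_set D.
Proof.
apply/seteqP; split=> z.
  move=> [/bigsetU_memE[v _ ->]|/bigsetU_memE[e /andP[eG _] ez]].
    by left; exists v.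
  by right; exists e.
move=> [[v _ <-]|[e eG ez]]; first by left; apply/bigsetU_memE; exists v.
by right; apply/bigsetU_memE; exists e => //; rewrite eG finset.subsetT.
Qed.

Lemma arc_point e t : e \in edges G -> t \in `[0, 1]%R ->
  t \in `]0, 1[%R \/ exists2 v, v \in e & edge_arc D e t = vertex_point D v.
Proof.
move=> eG; rewrite !in_itv /= => /andP[t0 t1].
have [->|tn0] := eqVneq t 0; last have [->|tn1] := eqVneq t 1.
- right; have : [set edge_arc D e 0; edge_arc D e 1] (edge_arc D e 0) by left.
  by rewrite arc_ends // => -[v ve <-]; exists v.
- right; have : [set edge_arc D e 0; edge_arc D e 1] (edge_arc D e 1) by right.
  by rewrite arc_ends // => -[v ve <-]; exists v.
- by left; rewrite !lt_neqAle t0 t1 tn1 eq_sym tn0.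
Qed.

Lemma drawn_vertex S v : v \in S -> drawn S (vertex_point D v).
Proof. by move=> vS; left; apply/bigsetU_memE; exists v. Qed.

Lemma arc_avoids_vertex e v t : e \in edges G -> t \in `[0, 1]%R -> v \notin e ->
  edge_arc D e t <> vertex_point D v.
Proof.
move=> eG /(arc_point eG)[t01 _|[w we ->] ve /point_inj wv]; first exact: arc_avoids_points.
by rewrite -wv we in ve.
Qed.

(** Arcs of a drawing meet other arcs and vertices only at their ends, and the ends of an arc drawn
    for S are vertices of S, hence not of T. *)
Lemma drawn_disjoint S T : (forall v, v \in S -> v \notin T) -> drawn S `&` drawn T = set0.
Proof.
move=> nST; apply/seteqP; split=> z //=.
have nTS v : v \in T -> v \notin S by move=> vT; apply/negP => /nST; rewrite vT.
case=> [[/bigsetU_memE[v vS ->]|/bigsetU_memE[e /andP[eG eS] [s s01 <-]]]].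
  move=> [/bigsetU_memE[w wT /point_inj vw]|/bigsetU_memE[f /andP[fG fT] [t t01 E]]].
    by have := nST _ vS; rewrite vw wT.
  apply: (arc_avoids_vertex fG t01 _ E); apply: contra (nST _ vS).
  exact: (fintype.subsetP fT).
move=> [/bigsetU_memE[w wT E]|/bigsetU_memE[f /andP[fG fT] [t t01 E]]].
  apply: (arc_avoids_vertex eG s01 _ E); apply: contra (nTS _ wT).
  exact: (fintype.subsetP eS).
have [s01'|[v ve E']] := arc_point eG s01; last first.
  apply: (arc_avoids_vertex fG t01 _ (etrans E E')).
  by apply: contra (nST _ (fintype.subsetP eS _ ve)); exact: (fintype.subsetP fT).
have [t01'|[v vf E']] := arc_point fG t01; last first.
  apply: (arc_avoids_vertex eG s01 _ (etrans (esym E) E')).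
  by apply: contra (nTS _ (fintype.subsetP fT _ vf)); exact: (fintype.subsetP eS).
apply: (arcs_disjoint fG eG _ t01' s01' E).
apply/eqP => fe; move: eG; rewrite /edges => /imsetP[[a b] _ /= eab].
have ae : a \in e by rewrite eab !inE eqxx.
have := nST _ (fintype.subsetP eS _ ae).
by rewrite (fintype.subsetP fT) // fe.
Qed.

Lemma adj_edge u v : adj u v -> [set u; v]%SET \in edges G.
Proof. by move=> uv; apply/imsetP; exists (u, v); rewrite ?inE. Qed.

Lemma drawn_adj_linked S u v : adj u v -> u \in S -> v \in S ->
  linked (drawn S) (vertex_point D u) (vertex_point D v).
Proof.
move=> uv uS vS; have eG := adj_edge uv; set e := [set u; v]%SET in eG.
have eS : e \subset S by apply/fintype.subsetP => w; rewrite !inE => /orP[] /eqP ->.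
have ends w : w \in e -> arc_image e (vertex_point D w).
  move=> we; have : (vertex_point D @` [set` e]) (vertex_point D w) by exists w.
  rewrite -(arc_ends D eG) => -[] ->.
    by exists 0 => //=; rewrite in_itv /= lexx ler01.
  by exists 1 => //=; rewrite in_itv /= lexx ler01.
apply: (@linked_sub _ (arc_image e)).
  by move=> z ez; right; apply/bigsetU_memE; exists e => //; rewrite eG eS.
apply: connected_linked; last 2 first.
- by apply: ends; rewrite !inE eqxx.
- by apply: ends; rewrite !inE eqxx orbT.
apply: connected_continuous_connected; first exact: segment_connected.
exact: arc_continuous.
Qed.

Lemma drawn_connected_linked S u v : connected_in S -> u \in S -> v \in S ->
  linked (drawn S) (vertex_point D u) (vertex_point D v).
Proof.
move=> cS uS vS; have /connectP[p pp ->] := cS u v uS vS.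
elim: p u uS pp {v vS} => [|w p IH] u uS /=.
  by move=> _; apply: linked_refl; exact: drawn_vertex.
by case/andP => /and3P[uw _ wS] /(IH _ wS); apply: linked_trans; exact: drawn_adj_linked.
Qed.

Lemma drawn_sub S T : S \subset T -> drawn S `<=` drawn T.
Proof.
move=> ST z [/bigsetU_memE[v vS ->]|/bigsetU_memE[e /andP[eG eS] ez]].
  by apply: drawn_vertex; exact: (fintype.subsetP ST).
by right; apply/bigsetU_memE; exists e => //; rewrite eG (fintype.subset_trans eS ST).
Qed.

Lemma drawn_star_linked S p v : connected_in S -> (exists2 w, w \in S & adj p w) ->
  v \in S -> linked (drawn (p |: S)%SET) (vertex_point D p) (vertex_point D v).
Proof.
move=> cS [w wS pw] vS; apply: (@linked_trans _ _ _ (vertex_point D w)).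
  by apply: drawn_adj_linked => //; rewrite !inE ?eqxx ?wS ?orbT.
apply: (@linked_sub _ (drawn S)); first by apply: drawn_sub; exact: subsetU1.
exact: drawn_connected_linked.
Qed.

(** Since v lies in the closure of F, some point y of F is so close to v that the segment between
    them misses everything drawn without v. From z to y the link stays in the complement of the
    drawing. The segment may cross arcs that end at v, hence the restriction on T. *)
Lemma face_vertex_linked F z v : is_face D F -> F z -> closure F (vertex_point D v) ->
  exists L, [/\ compact L, linked L z (vertex_point D v) &
    forall T, v \notin T -> L `&` drawn T = set0].
Proof.
move=> [p pD FE] Fz Fv.
pose U := ~` drawn_set D.
have oU : open U by apply: closed_openC; rewrite -drawnT; exact: drawn_closed.
have FU : F `<=` U by rewrite FE; exact: connected_component_sub.
have cF : connected F by rewrite FE; exact: component_connected.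
pose W := drawn (~: [set v])%SET.
have vW : (~` W) (vertex_point D v).
  move=> hW; have : (drawn [set v]%SET `&` W) (vertex_point D v).
    by split=> //; apply: drawn_vertex; rewrite inE.
  by rewrite drawn_disjoint // => w; rewrite !inE => /eqP ->; rewrite eqxx.
have : nbhs (vertex_point D v) (~` W).
  by apply: open_nbhs_nbhs; split=> //; apply: closed_openC; exact: drawn_closed.
move=> /nbhs_ballP[r /= r0 rW].
have [y [Fy vy]] := Fv _ (nbhsx_ballx _ _ r0).
have [K [cK KU lK]] := open_connected_linked oU cF FU Fz Fy.
exists (K `|` segment_set (vertex_point D v) y); split.
- by apply: compactU => //; exact: segment_set_compact.
- apply: (@linked_trans _ _ _ y); first by apply: linked_sub lK; exact: subsetUl.
  apply: linked_sym; apply: (linked_sub _ (@segment_set_linked _ _ _)).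
  exact: subsetUr.
move=> T vT; apply/seteqP; split=> x //= [Lx Tx].
have Wx : W x.
  apply: drawn_sub Tx; apply/fintype.subsetP => w wT; rewrite !inE.
  by apply: contra vT => /eqP <-.
case: Lx => [/KU|/(segment_set_ball vy)/rW//].
by apply; rewrite -drawnT; apply: drawn_sub Wx; exact: finset.subsetT.
Qed.

(** The K_{3,3} has p, q and a point z of the face on one side and a vertex [m j] of each [M j] on
    the other. Its edges are realised by the drawings of p and q together with the [M j], and by the
    links [L j] from z. *)
Lemma outer_no_K23 F (p q : G) (M : nat -> {set G}) : is_face D F ->
  (forall v, closure F (vertex_point D v)) ->
  p != q ->
  (forall j, j < 3 -> [/\ connected_in (M j), p \notin M j, q \notin M j,
     exists2 w, w \in M j & adj p w & exists2 w, w \in M j & adj q w])%N ->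
  ~ (forall j l, j < 3 -> l < 3 -> j != l -> forall v, v \in M j -> v \notin M l)%N.
Proof.
move=> fF cF pq hM dM.
have [z Fz] : exists z, F z.
  have [y [Fy _]] := cF p _ (nbhsx_ballx _ _ ltr01); by exists y.
have : forall j, exists v, (j < 3)%N -> v \in M j.
  move=> j; case: (ltnP j 3) => j3; last by exists p.
  by have [_ _ _ [w wM _] _] := hM j j3; exists w.
move=> /choice[m hm].
have /choice[L hL] j := face_vertex_linked fF Fz (cF (m j)).
(* The default values of [nth] provide the third row, the point z and the links [L j]. *)
pose u i := nth z [:: vertex_point D p; vertex_point D q] i.
pose K i j := nth (L j) [:: drawn (p |: M j)%SET; drawn (q |: M j)%SET] i.
apply: (@topological_K33 R u (fun j => vertex_point D (m j)) K).
- move=> [|[|[|//]]] j _ j3; [exact: drawn_compact|exact: drawn_compact|].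
  by case: (hL j).
- move=> [|[|[|//]]] j _ j3; last by case: (hL j).
  + by have [cM _ _ hp hq] := hM j j3; apply: drawn_star_linked (hm j j3).
  + by have [cM _ _ hp hq] := hM j j3; apply: drawn_star_linked (hm j j3).
have dpq j l : (j < 3)%N -> (l < 3)%N -> j != l ->
    forall x, x \in (p |: M j)%SET -> x \notin (q |: M l)%SET.
  move=> j3 l3 jl; have [_ pj qj _ _] := hM j j3; have [_ pl ql _ _] := hM l l3.
  move=> x; rewrite !inE => /orP[/eqP ->|xj]; first by rewrite negb_or pq.
  by rewrite negb_or (dM j l) // andbT; apply: contra qj => /eqP <-.
have mnot x j l : (j < 3)%N -> (l < 3)%N -> j != l -> m j != x -> m j \notin (x |: M l)%SET.
  move=> j3 l3 jl mx; rewrite !inE negb_or mx /=.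
  by apply: (dM j l) => //; exact: hm.
have mp j : (j < 3)%N -> m j != p.
  by move=> j3; have [_ pj _ _ _] := hM j j3; apply: contra pj => /eqP <-; exact: hm.
have mq j : (j < 3)%N -> m j != q.
  by move=> j3; have [_ _ qj _ _] := hM j j3; apply: contra qj => /eqP <-; exact: hm.
have Lp j l : (j < 3)%N -> (l < 3)%N -> j != l -> L j `&` drawn (p |: M l)%SET = set0.
  by move=> j3 l3 jl; have [_ _] := hL j; apply; apply: mnot => //; exact: mp.
have Lq j l : (j < 3)%N -> (l < 3)%N -> j != l -> L j `&` drawn (q |: M l)%SET = set0.
  by move=> j3 l3 jl; have [_ _] := hL j; apply; apply: mnot => //; exact: mq.
move=> [|[|[|//]]] j [|[|[|//]]] l // _ j3 _ l3 _ jl; rewrite /K /=.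
- by apply: drawn_disjoint; exact: dpq.
- by rewrite setIC Lp // eq_sym.
- by rewrite setIC; apply: drawn_disjoint; apply: dpq => //; rewrite eq_sym.
- by rewrite setIC Lq // eq_sym.
- by rewrite Lp.
- by rewrite Lq.
Qed.

End DrawnSubgraphs.

(* Plain [lia] is exponential in the boolean hypotheses that are cleared here. *)
Ltac natlia :=
  repeat match goal with
  | H : ?T |- _ =>
    match type of T with Prop => idtac end;
    lazymatch T with
    | is_true (leq _ _) => fail
    | is_true (andb (leq _ _) (leq _ _)) => fail
    | is_true (negb (andb (leq _ _) (leq _ _))) => fail
    | is_true (negb (eq_op _ _)) => fail
    | _ \/ _ => fail
    | not _ => fail
    | @eq nat _ _ => fail
    | _ => clear H
    end
  end; lia.

(** * Greedy colouring along a path with prescribed ends *)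

Section PathColouring.
Variable k : nat.
Implicit Types (c z : 'I_k) (f : nat -> 'I_k).

Lemma fresh_colour (F : seq 'I_k) : size F < k -> exists c, c \notin F.
Proof.
move=> Fk; apply: contrapT => /forallNP h.
have : size (enum 'I_k) <= size F.
  apply: uniq_leq_size; first exact: enum_uniq.
  by move=> c _; apply: contrapT => /negP; exact: h.
by rewrite size_enum_ord leqNgt Fk.
Qed.

(** Induction from the left: the next colour avoids the two before it, and also w0 and w1, so that
    the hypotheses hold again for the shorter path. *)
Lemma fill_distance2 n (u0 u1 w0 w1 : 'I_k) : 4 < k ->
  u0 != u1 -> w0 != w1 -> u1 != w0 -> u0 != w0 -> u1 != w1 ->
  exists f, [/\ f 0 = u0, f 1 = u1, f n.+2 = w0, f n.+3 = w1 &
    (forall i, i < n.+3 -> f i != f i.+1) /\ (forall i, i < n.+2 -> f i != f i.+2)].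
Proof.
move=> k4; elim: n u0 u1 => [|n IH] u0 u1 u01 w01 uw1 uw0 uw2.
  exists (nth u0 [:: u0; u1; w0; w1]); split=> //.
  by split=> [[|[|[|]]]|[|[|]]].
have [c] := @fresh_colour [:: u0; u1; w0; w1] k4.
rewrite !inE !negb_or => /and4P[c0 c1 c2 c3].
have [|g [g0 g1 g2 g3 [h1 h2]]] := IH u1 c _ w01 c2 uw1 c3; first by rewrite eq_sym.
exists (fun i => if i is j.+1 then g j else u0); split=> //.
split=> [[|i]|[|i]]; rewrite ?g0 ?g1 // ?ltnS; [exact: h1| |exact: h2].
by rewrite eq_sym.
Qed.

(** Each new colour avoids five others: its predecessor, three values of [g], and the final colour
    z, which keeps the hypothesis of the induction. *)
Lemma fill_vertex_colours r (g : nat -> 'I_k) c0 z : 5 < k -> c0 != z ->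
  exists f, [/\ f 0 = c0, f r.+1 = z, (forall i, i <= r -> f i != f i.+1) &
    forall i, i < r -> [/\ f i.+1 != g i, f i.+1 != g i.+1 & f i.+1 != g i.+2]].
Proof.
move=> k5; elim: r g c0 => [|r IH] g c0 c0z.
  exists (fun i => if i is 0 then c0 else z); split=> //.
  by case.
have [c] := @fresh_colour [:: c0; z; g 0; g 1; g 2] k5.
rewrite !inE !negb_or => /and5P[cc0 cz cg0 cg1 cg2].
have [f [f0 fr h1 h2]] := IH (fun i => g i.+1) c cz.
exists (fun i => if i is j.+1 then f j else c0); split=> //.
- by move=> [|i]; [rewrite f0 eq_sym|exact: h1].
- by move=> [|i]; [rewrite f0|exact: h2].
Qed.

End PathColouring.

(** * Colouring a Hamiltonian graph without crossing chords, its vertices numbered along the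
    cycle *)

Section OrderedGraph.
Variables (k Delta : nat) (e : rel nat).
Hypotheses (k7 : 6 < k) (kD : Delta.+1 < k).
Hypotheses (esym : symmetric e) (eirr : irreflexive e).

(** The value [a v] is the colour of the vertex v and [b v] the common colour of I_2(v), within the
    subgraph induced by [s]. *)
Definition good_colouring (s : seq nat) (a b : nat -> 'I_k) : Prop :=
  [/\ forall u v : nat, u \in s -> v \in s -> e u v ->
        [/\ a u != a v, b u != b v & a u != b v],
      forall u : nat, u \in s -> a u != b u &
      forall u v w : nat, u \in s -> v \in s -> w \in s -> u != w -> e u v -> e v w ->
        b u != b w].

Definition consecutive (P : seq nat) u v := exists2 i, i.+1 < size P &
  u = nth 0 P i /\ v = nth 0 P i.+1 \/ v = nth 0 P i /\ u = nth 0 P i.+1.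

Lemma consecutive_rev P u v : consecutive P u v -> consecutive (rev P) u v.
Proof.
move=> [i iP h]; exists (size P - i.+2); first by rewrite size_rev; lia.
rewrite !nth_rev; try lia.
have -> : size P - (size P - i.+2).+1 = i.+1 by lia.
have -> : size P - (size P - i.+2).+2 = i by lia.
by case: h => -[-> ->]; [right|left].
Qed.

Lemma consecutive_index P u v : uniq P -> consecutive P u v ->
  [/\ u \in P, v \in P & index v P = (index u P).+1 \/ index u P = (index v P).+1].
Proof.
move=> uP [i iP h]; have iP' := ltnW iP.
have E := index_uniq 0 iP uP; have E' := index_uniq 0 iP' uP.
by case: h => -[-> ->]; rewrite !mem_nth // E E'; split=> //; [left|right].
Qed.

(** The path [m] is added between x and y. Its last vertex receives the [b]-colour [cy], which
    avoids at most Delta - 1 neighbours of y, [b y] and [a y]. Its first vertex receives [cx], which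
    avoids at most three neighbours of x, [b x], [a x] and [cy]. This makes at most Delta + 1 and 6
    constraints. The rest of [b], and then [a], is filled in along the path. *)
Lemma extend_colouring (S m : seq nat) (x y : nat) a b : good_colouring S a b ->
  x \in S -> y \in S -> e x y -> 1 < size m -> uniq (x :: rcons m y) ->
  {in m, forall v : nat, v \notin S} ->
  {in m, forall v u : nat, u \in S ++ m -> e v u -> consecutive (x :: rcons m y) v u} ->
  count (e x) S <= 3 -> count (e y) S < Delta ->
  exists a' b', good_colouring (S ++ m) a' b'.
Proof.
move=> [g1 g2 g3] xS yS exy m1; set P := x :: rcons m y => uP mS nbr dx dy.
have [|cy] := @fresh_colour k ([seq b v | v <- seq.filter (e y) S] ++ [:: b y; a y]) _.
  by rewrite size_cat size_map size_filter /=; clear -dy kD; lia.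
rewrite mem_cat !inE !negb_or => /and3P[cyN cyb cya].
have [|cx] := @fresh_colour k ([seq b v | v <- seq.filter (e x) S] ++ [:: b x; a x; cy]) _.
  by rewrite size_cat size_map size_filter /=; clear -dx k7; lia.
rewrite mem_cat !inE !negb_or => /and4P[cxN cxb cxa cxy].
have cyNP v : v \in S -> e y v -> cy != b v.
  by move=> vS yv; apply: contra cyN => /eqP ->; rewrite map_f // mem_filter yv.
have cxNP v : v \in S -> e x v -> cx != b v.
  by move=> vS xv; apply: contra cxN => /eqP ->; rewrite map_f // mem_filter xv.
(* Positions 0 and [size m] + 1 are x and y, positions 1 and [size m] the ends of [m], so
   [(size m).-2] positions remain free. *)
have [||||||be [b0 b1 br br1 [bc bcc]]] :=
    @fill_distance2 k (size m).-2 (b x) cx cy (b y).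
- by apply: leq_trans k7.
- by rewrite eq_sym.
- by [].
- by [].
- by rewrite eq_sym; apply: cyNP => //; rewrite esym.
- exact: cxNP.
have sm : (size m).-2.+2 = size m by case: (m) m1 => [|? []].
have sm3 : (size m).-2.+3 = (size m).+1 by rewrite sm.
rewrite sm in br br1 bcc.
have [||al [a0 ar ac ab]] := @fill_vertex_colours k (size m) be (a x) (a y).
- by apply: leq_trans k7.
- by case: (g1 x y xS yS exy).
have {}ab1 i : i <= size m -> al i != be i.+1.
  by case: i => [_|i /ab[]//]; rewrite a0 b1 eq_sym.
have {}ab2 i : i <= size m -> al i.+1 != be i.
  rewrite leq_eqVlt => /orP[/eqP ->|/ab[]//].
  by rewrite ar br eq_sym.
have ab0 i : 0 < i <= size m -> al i != be i.
  by case: i => // i /ab[].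
pose a' v := if v \in m then al (index v P) else a v.
pose b' v := if v \in m then be (index v P) else b v.
have xm : x \notin m by apply/negP => /mS; rewrite xS.
have ym : y \notin m by apply/negP => /mS; rewrite yS.
have idx : index x P = 0 by rewrite /P /= eqxx.
have idy : index y P = (size m).+1.
  have yx : x != y by apply/eqP => E; rewrite E eirr in exy.
  by rewrite /P /= (negbTE yx) -cats1 index_cat (negbTE ym) /= eqxx addn0.
have idm v : v \in m -> 0 < index v P <= size m.
  move=> vm; have vx : x != v by apply/eqP => E; rewrite E vm in xm.
  by rewrite /P /= (negbTE vx) -cats1 index_cat vm /= index_mem.
have aP v : v \in P -> a' v = al (index v P).
  rewrite /P inE mem_rcons inE /a'; case: ifP => // vm.
  by rewrite orbF => /orP[] /eqP ->; rewrite ?idx ?idy.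
have bP v : v \in P -> b' v = be (index v P).
  rewrite /P inE mem_rcons inE /b'; case: ifP => // vm.
  by rewrite orbF => /orP[] /eqP ->; rewrite ?idx ?idy.
have szP : size P = (size m).+2 by rewrite /P /= size_rcons.
have sS v : v \in S ++ m -> v \notin m -> v \in S.
  by rewrite mem_cat => /orP[//|->].
have aS v : v \notin m -> a' v = a v by rewrite /a' => /negbTE ->.
have bS v : v \notin m -> b' v = b v by rewrite /b' => /negbTE ->.
have nbrP u v : u \in S ++ m -> v \in S ++ m -> (u \in m) || (v \in m) -> e u v ->
    [/\ u \in P, v \in P & index v P = (index u P).+1 \/ index u P = (index v P).+1].
  move=> uS vS /orP[um|vm] uv; apply: consecutive_index => //; first exact: nbr.
  rewrite esym in uv; have [i iP h] := nbr v vm u uS uv; exists i => //.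
  by case: h; [right|left].
exists a', b'; split.
- move=> u v uS vS uv; case: (boolP ((u \in m) || (v \in m))) => [h|]; last first.
    rewrite negb_or => /andP[um vm]; rewrite !aS ?bS //.
    by apply: g1 => //; exact: sS.
  have [uP' vP' h'] := nbrP u v uS vS h uv.
  have iu : index u P < (size m).+2 by rewrite -szP index_mem.
  have iv : index v P < (size m).+2 by rewrite -szP index_mem.
  rewrite !aP ?bP //; case: h' => E; rewrite E in iu iv *.
    by split; [exact: ac|apply: bc; rewrite sm3|exact: ab1].
  by split; [rewrite eq_sym; exact: ac|rewrite eq_sym; apply: bc; rewrite sm3|exact: ab2].
- move=> u uS; case: (boolP (u \in m)) => um.
    by rewrite /a' /b' um; apply: ab0; exact: idm.
  by rewrite aS ?bS //; apply: g2; exact: sS.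
(* A middle vertex outside [m] with a neighbour in [m] is x or y. Then u is the end of [m] next to
   it, whose colour [cx] or [cy] was chosen against the old neighbours. *)
have key u v w : u \in m -> v \in S ++ m -> v \notin m -> w \in S ++ m -> u != w ->
    e u v -> e v w -> b' u != b' w.
  move=> um vS vm wS uw uv vw.
  have uS : u \in S ++ m by rewrite mem_cat um orbT.
  have [uP' vP' h] := nbrP u v uS vS (introT orP (or_introl um)) uv.
  have iu := idm u um.
  have vxy : v = x \/ v = y.
    move: vP'; rewrite /P inE mem_rcons inE (negbTE vm) orbF.
    by case/orP => /eqP ->; [left|right].
  have wm : w \notin m.
    apply/negP => wm; have [_ wP' h'] := nbrP v w vS wS (introT orP (or_intror wm)) vw.
    have iw := idm w wm.
    case/negP: uw; apply/eqP; rewrite -(nth_index 0 uP') -(nth_index 0 wP').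
    congr (nth 0 P _).
    case: vxy => Ev.
      by rewrite Ev idx in h h'; clear -h h' iu iw; lia.
    by rewrite Ev idy in h h'; clear -h h' iu iw; lia.
  rewrite (bS w) // (bP u) //.
  case: vxy => Ev.
    have -> : index u P = 1 by rewrite Ev idx in h; clear -h iu; lia.
    by rewrite b1; apply: cxNP; [exact: sS|rewrite -Ev].
  have -> : index u P = size m by rewrite Ev idy in h; clear -h iu; lia.
  by rewrite br; apply: cyNP; [exact: sS|rewrite -Ev].
move=> u v w uS vS wS uw uv vw.
case: (boolP (v \in m)) => vm.
  have [uP' vP' hu] := nbrP u v uS vS (introT orP (or_intror vm)) uv.
  have [_ wP' hw] := nbrP v w vS wS (introT orP (or_introl vm)) vw.
  have iv := idm v vm.
  have iuw : index u P != index w P.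
    apply: contra uw => /eqP E; apply/eqP.
    by rewrite -(nth_index 0 uP') -(nth_index 0 wP') E.
  rewrite !bP //.
  have [E|E] : index w P = (index u P).+2 \/ index u P = (index w P).+2.
    by clear -hu hw iv iuw; lia.
    by rewrite E; apply: bcc; clear -hu hw iv E; lia.
  by rewrite E eq_sym; apply: bcc; clear -hu hw iv E; lia.
case: (boolP (u \in m)) => um; first exact: (key u v w).
case: (boolP (w \in m)) => wm.
  by rewrite eq_sym; apply: (key w v u); rewrite // 1?eq_sym // esym.
by rewrite !bS //; apply: (g3 u v w) => //; exact: sS.
Qed.

Definition noncrossing := forall i j l p : nat, i < j < l -> l < p -> e i l -> e j p -> False.

Definition triangle_free := forall i j l : nat, e i j -> e j l -> e i l -> False.

(** The vertex in between excludes the edges of the path, while the edge that closes the cycle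
    counts as a chord. *)
Definition chord (s : seq nat) (x y : nat) :=
  [&& x \in s, y \in s, x < y, e x y & has (fun z => x < z < y) s].

(** A minimal chord: x, y and the vertices between them bound a single face. *)
Definition leaf_chord (s : seq nat) (x y : nat) := chord s x y /\
  forall x' y' : nat, chord s x' y' -> x <= x' -> y' <= y -> x' = x /\ y' = y.

(** The degree bound that [extend_colouring] requires at one end of the chord. *)
Definition few_outside (s : seq nat) (x y v : nat) :=
  forall u : seq nat, uniq u -> {subset u <= s} ->
    {in u, forall w : nat, ~~ (x < w < y)} -> count (e v) u <= 3.

Lemma chordP (s : seq nat) (x y z : nat) : x \in s -> y \in s -> z \in s -> x < z < y -> e x y ->
  chord s x y.
Proof.
move=> xs ys zs h exy; rewrite /chord xs ys exy /= andbC.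
by apply/andP; split; [apply/hasP; exists z|natlia].
Qed.

Lemma count_le3 (v y : nat) (L u : seq nat) : uniq u -> size L <= 2 ->
  (forall w, w \in u -> e v w -> w = y \/ w \in L) -> count (e v) u <= 3.
Proof.
move=> uu sL h; rewrite -size_filter.
apply: (@leq_trans (size (y :: L))); last by rewrite /= ltnS.
apply: uniq_leq_size; first exact: filter_uniq.
move=> w; rewrite mem_filter => /andP[vw wu].
by rewrite inE; case: (h w wu vw) => [->|->]; rewrite ?eqxx ?orbT.
Qed.

Lemma sorted_size_le2 (L : seq nat) : sorted ltn L ->
  (forall a b c : nat, a \in L -> b \in L -> c \in L -> a < b < c -> False) ->
  size L <= 2.
Proof.
case: L => [|a [|b [|c L]]] //= /and3P[ab bc _] h; exfalso.
by apply: (h a b c); rewrite ?inE ?eqxx ?orbT ?ab.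
Qed.

(** An end of xy strictly between p and q has all its neighbours within pq. A neighbour beyond the
    other end would give a chord around xy or an edge across pq. On its own side there are at most
    two neighbours, since three would give nested chords, contrary to [inner]. The other end of xy
    is the third. *)
Lemma inner_leaf (s : seq nat) (p q x y : nat) : noncrossing -> sorted ltn s ->
  chord s p q -> chord s x y -> p <= x -> y <= q -> p < x \/ y < q ->
  (forall x' y' : nat, chord s x' y' -> p <= x' -> y' <= q -> p < x' \/ y' < q ->
     leaf_chord s x' y') ->
  few_outside s x y x \/ few_outside s x y y.
Proof.
move=> nc ss /and5P[ps qs pq epq _] cxy px yq strict inner.
have /and5P[xs ys xy exy _] := cxy.
have tr : transitive ltn by exact: ltn_trans.
have [px'|[pEx yq']] : p < x \/ (p = x /\ y < q) by natlia.
  left=> u uu us out.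
  apply: (@count_le3 x y [seq w <- s | (w < x) && e x w]) => //.
    apply: sorted_size_le2; first exact: sorted_filter.
    move=> a b c; rewrite !mem_filter.
    move=> /andP[/andP[ax xa] sa] /andP[/andP[bx xb] sb] /andP[/andP[cx xc] sc] abc.
    rewrite esym in xa; rewrite esym in xb.
    have pa : p <= a.
      by rewrite leqNgt; apply/negP => ap; apply: (nc a p x q) => //; natlia.
    have ca : chord s a x by apply: (chordP sa xs sb) => //; natlia.
    have cb : chord s b x by apply: (chordP sb xs sc) => //; natlia.
    have [_ /(_ b x cb)] : leaf_chord s a x by apply: inner => //; natlia.
    by move=> []; natlia.
  move=> w wu xw; have ws := us w wu; have := out w wu.
  have [wx|wx|wx] := ltngtP w x; first by rewrite mem_filter wx xw ws; right.
    have [wy|wy|->] := ltngtP w y => // _; last by left.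
    have wq : w <= q.
      by rewrite leqNgt; apply/negP => qw; apply: (nc p x q w) => //; natlia.
    have cw : chord s x w by apply: (chordP xs ws ys) => //; natlia.
    have [_ /(_ x y cxy)] : leaf_chord s x w by apply: inner => //; natlia.
    by move=> []; natlia.
  by rewrite wx eirr in xw.
right=> u uu us out.
apply: (@count_le3 y x [seq w <- s | (y < w) && e y w]) => //.
  apply: sorted_size_le2; first exact: sorted_filter.
  move=> a b c; rewrite !mem_filter.
  move=> /andP[/andP[ya eya] sa] /andP[/andP[yb eyb] sb] /andP[/andP[yc eyc] sc] abc.
  have cq : c <= q.
    by rewrite leqNgt; apply/negP => qc; apply: (nc p y q c) => //; natlia.
  have cc : chord s y c by apply: (chordP ys sc sb) => //; natlia.
  have cb : chord s y b by apply: (chordP ys sb sa) => //; natlia.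
  have [_ /(_ y b cb)] : leaf_chord s y c by apply: inner => //; natlia.
  by move=> []; natlia.
move=> w wu yw; have ws := us w wu; have := out w wu.
have [wy|wy|wy] := ltngtP w y.
- have [wx|wx|->] := ltngtP w x => // _; last by left.
  have pw : p <= w.
    by rewrite leqNgt; apply/negP => wp; apply: (nc w p y q) => //; rewrite 1?esym //; natlia.
  by natlia.
- by rewrite mem_filter wy yw ws; right.
- by rewrite wy eirr in yw.
Qed.

(** If the closing edge contains no other chord, it is the leaf itself. Otherwise a shortest chord
    pq with another chord inside it has only leaves inside, and [inner_leaf] applies. *)
Lemma exists_leaf (h : nat) (t : seq nat) : noncrossing -> path ltn h t -> 1 < size t ->
  e h (last h t) -> exists x y : nat, leaf_chord (h :: t) x y /\
    (few_outside (h :: t) x y x \/ few_outside (h :: t) x y y).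
Proof.
move=> nc st s1 ehl; set s := h :: t; set l := last h t in ehl *.
have ss : sorted ltn s by [].
have bnd w : w \in s -> h <= w <= l.
  have hm : all (leq h) s.
    rewrite /= leqnn; have := order_path_min ltn_trans st.
    by apply: sub_all => ? /ltnW.
  move=> ws; rewrite (allP hm) //=.
  have := st; rewrite /l; move: ws; rewrite /s; elim: (t) (h) w => [|a t' IH] b w /=.
    by rewrite inE => /eqP ->.
  rewrite inE => /orP[/eqP ->|wt] /andP[ba pa]; last exact: IH.
  by apply: leq_trans (ltnW ba) (IH a a _ pa); rewrite inE eqxx.
have hs : h \in s by exact: mem_head.
have ls : l \in s by exact: mem_last.
have chord_root : chord s h l.
  have [a [as_ hal]] : exists a, a \in s /\ h < a < l.
    case: (t) s1 st @l @s ss bnd {ehl hs ls} => [|a [|b t']] //= _ /and3P[ha ab _] _ bnd.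
    exists a; rewrite !inE eqxx orbT ha; split=> //; apply: leq_trans ab _.
    have bm : b \in [:: h, a, b & t'] by rewrite !inE eqxx !orbT.
    by case/andP: (bnd b bm).
  exact: chordP hal ehl.
pose nonleaf (p q : nat) := chord s p q /\ exists x y : nat,
  [/\ chord s x y, p <= x, y <= q & p < x \/ y < q].
have [[p [q nl]]|nn] := pselect (exists p q, nonleaf p q); last first.
  exists h, l; split.
    split=> // x' y' c hx yl; apply: contrapT => nE; apply: nn.
    by exists h, l; split=> //; exists x', y'; split=> //; natlia.
  (* All vertices lie between h and l, so only these two lie outside the open interval. *)
  left=> u uu us out; apply: (@count_le3 h l [:: h]) => // w wu _.
  have := out w wu; have := bnd w (us w wu); rewrite inE => b1 b2.
  by have [->|->] : w = h \/ w = l by [natlia]; [right; rewrite eqxx|left].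
have : exists d, `[< exists p q, nonleaf p q /\ q - p = d >].
  by exists (q - p); apply/asboolP; exists p, q.
move=> /ex_minnP[d /asboolP[{nl}p' [q' [nl E]]] dmin].
move: p' q' nl E => {p q} p q nl E.
have [cpq [x [y [cxy px yq strict]]]] := nl.
have inner x' y' : chord s x' y' -> p <= x' -> y' <= q -> p < x' \/ y' < q ->
    leaf_chord s x' y'.
  move=> c' px' yq' str'; split=> // x2 y2 c2 xx2 yy2; apply: contrapT => nE.
  have /dmin : `[< exists p q, nonleaf p q /\ q - p = y' - x' >].
    apply/asboolP; exists x', y'; split=> //; split=> //.
    by exists x2, y2; split=> //; natlia.
  by case/and5P: c' => _ _ ? _ _; natlia.
exists x, y; split; first exact: inner.
exact: (inner_leaf nc ss cpq cxy px yq strict inner).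
Qed.

Lemma good_colouring_sub (s s' : seq nat) a b : {subset s' <= s} ->
  good_colouring s a b -> good_colouring s' a b.
Proof.
move=> ss [h1 h2 h3]; split=> [u v /ss us /ss vs|u /ss|u v w /ss us /ss vs /ss ws].
- exact: h1.
- exact: h2.
- exact: h3.
Qed.

Lemma edge_colouring (x y : nat) : x != y -> exists a b, good_colouring [:: x; y] a b.
Proof.
move=> xy; have k4 : 3 < k by natlia.
pose col i (hi : i < 4) := Ordinal (leq_trans hi k4).
exists (fun v => if v == x then @col 0 isT else @col 1 isT).
exists (fun v => if v == x then @col 2 isT else @col 3 isT).
have yx : (y == x) = false by rewrite eq_sym (negbTE xy).
split.
- move=> u v; rewrite !inE => /orP[] /eqP -> /orP[] /eqP ->; rewrite ?eirr // ?yx ?eqxx;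
  by split.
- by move=> u; rewrite !inE => /orP[] /eqP ->; rewrite ?yx ?eqxx.
- move=> u v w; rewrite !inE => /orP[] /eqP -> /orP[] /eqP -> /orP[] /eqP ->;
  by rewrite ?eirr ?eqxx // ?yx.
Qed.

(** A vertex of [P] between u and v would make uv a chord strictly inside the leaf. *)
Lemma leaf_consecutive (s : seq nat) (x y : nat) (P : seq nat) (u v : nat) : leaf_chord s x y ->
  sorted ltn P -> {subset P <= s} -> u \in P -> v \in P -> x <= u -> u < v -> v <= y ->
  x < u \/ v < y -> e u v -> consecutive P u v.
Proof.
move=> [_ lf] sP Ps uP vP xu uv vy strict euv.
have mono i j : j < size P -> i < j -> nth 0 P i < nth 0 P j.
  move=> jP ij; apply: (sorted_ltn_nth ltn_trans 0 sP); rewrite ?inE //.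
  exact: ltn_trans jP.
have iu : index u P < size P by rewrite index_mem.
have iv : index v P < size P by rewrite index_mem.
have uvi : index u P < index v P.
  rewrite ltnNge leq_eqVlt; apply/negP => /orP[/eqP E|vi].
    by have := nth_index 0 vP; rewrite E (nth_index 0 uP); natlia.
  by have := mono _ _ iu vi; rewrite !nth_index //; natlia.
exists (index u P); first exact: leq_ltn_trans uvi iv.
left; rewrite nth_index //; split=> //.
have [E|ne] := eqVneq (index u P).+1 (index v P); first by rewrite E nth_index.
have h1 : (index u P).+1 < index v P by natlia.
have zP : (index u P).+1 < size P by exact: ltn_trans iv.
have := mono _ _ zP (ltnSn _); have := mono _ _ iv h1; rewrite !nth_index // => h2 h3.
have : chord s u v.
  by apply: (@chordP s u v (nth 0 P (index u P).+1)); rewrite ?h2 ?h3 ?Ps ?mem_nth.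
by move=> /lf; natlia.
Qed.

(** Induction on the number of vertices. The inner vertices [m] of a leaf chord xy are removed, and
    the edge xy completes the shorter cycle on [s']; [extend_colouring] then restores [m]. *)
Theorem ordered_colouring : noncrossing -> triangle_free -> 4 < Delta ->
  (forall v (u : seq nat), uniq u -> count (e v) u <= Delta) ->
  forall (h : nat) (t : seq nat), path ltn h t -> path e h t -> 0 < size t ->
  e h (last h t) -> exists a b, good_colouring (h :: t) a b.
Proof.
move=> nc tf D4 deg h t; have [n] := ubnP (size t).
elim: n h t => // n IH h t tn st pt t0 ehl.
have tr : transitive ltn by exact: ltn_trans.
case: (ltnP 1 (size t)) => t1; last first.
  case: t t0 t1 ehl {IH tn st pt} => [|y [|]] //= _ _ hy.
  by apply: edge_colouring; apply/eqP => E; rewrite E eirr in hy.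
have [x [y [lf few]]] := exists_leaf nc st t1 ehl.
have [/and5P[xs ys xy exy hz] _] := lf.
have [s1 [m [s2 E]]] : exists s1 m s2, h :: t = s1 ++ x :: m ++ y :: s2.
  have ss : sorted ltn (h :: t) by [].
  case/splitPr: xs ss ys => s1 s3 ss ys.
  have : y \in s3.
    move: ys; rewrite mem_cat inE => /or3P[ys|/eqP E|//]; last by rewrite E ltnn in xy.
    move: ss; rewrite (sorted_pairwise tr) pairwise_cat => /andP[/allrelP /(_ y x ys)].
    by rewrite inE eqxx => /(_ isT) /=; natlia.
  by case/splitPr=> m s2; exists s1, m, s2.
set s := h :: t in E lf few xs ys hz *.
have ss : sorted ltn s by [].
have us : uniq s by apply: sorted_uniq ss => // ?; exact: ltnn.
have := ss; rewrite E (sorted_pairwise tr) pairwise_cat /= pairwise_cat /= all_cat /=.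
case/and3P=> /allrelP ord1 _ /andP[/and3P[/allP xm _ /allP xs2]].
case/and3P=> /allrelP my mpw /andP[/allP ys2 _].
have s1x v : v \in s1 -> v < x by move=> vs; apply: ord1; rewrite // inE eqxx.
have my' v : v \in m -> v < y by move=> vm; apply: my; rewrite // inE eqxx.
have m0 : m != [::].
  apply/eqP => m0; case/hasP: hz => z; rewrite E m0 /= mem_cat !inE.
  by case/or4P => [/s1x|/eqP ->|/eqP ->|/ys2] /=; natlia.
pose P := x :: rcons m y; pose s' := s1 ++ x :: y :: s2.
have ps : perm_eq s (s' ++ m).
  by rewrite E /s' -catA perm_cat2l /= perm_cons -cat_cons perm_catC.
have Es := perm_mem ps.
have sP : sorted ltn P.
  rewrite (sorted_pairwise tr) /P /= pairwise_rcons mpw andbT all_rcons /= xy /=.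
  by apply/andP; split; apply/allP.
have uP : uniq P by apply: sorted_uniq sP => // ?; exact: ltnn.
have Ps : {subset P <= s}.
  move=> v; rewrite inE mem_rcons inE E !(mem_cat, inE).
  by move=> /or3P[->|->|->]; rewrite ?orbT.
have : uniq (s' ++ m) by rewrite -(perm_uniq ps).
rewrite cat_uniq => /and3P[us' /hasPn ms' um].
have out : {in s', forall w : nat, ~~ (x < w < y)}.
  by move=> w; rewrite mem_cat !inE => /or4P[/s1x|/eqP ->|/eqP ->|/ys2] /=; natlia.
have sub' : {subset s' <= s} by move=> v vs; rewrite Es mem_cat vs.
have xs' : x \in s' by rewrite !(mem_cat, inE) eqxx orbT.
have ys' : y \in s' by rewrite !(mem_cat, inE) eqxx !orbT.
have [pm ezy ps'] : [/\ path e x m, e (last x m) y & sorted e s'].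
  have : sorted e s by []. rewrite E /s'.
  case: (s1) => [|h1 s1'] /=; rewrite ?cat_path /= ?cat_path /=.
    by case/and3P=> -> -> ->; rewrite exy.
  by case/and5P=> -> -> -> -> ->; rewrite exy.
have zm : last x m \in m by case: (m) m0 => //= z m' _; exact: mem_last.
(* A single inner vertex would form a triangle with x and y. *)
have m1 : 1 < size m.
  case: (m) m0 pm ezy => [|z [|]] //= _ /andP[xz _] zy.
  by case: (tf x z y).
(* The vertex of [m] next to y is a neighbour outside [s'], which makes the inequality strict. *)
have dy : count (e y) s' < Delta.
  have := deg y (last x m :: s'); rewrite /= us' andbT esym ezy add1n; apply.
  exact: ms'.
have dx : count (e x) s' < Delta.
  case: (m) m0 pm ms' => //= z m' _ /andP[xz _] ms'.
  have := deg x (z :: s'); rewrite /= us' andbT xz add1n; apply.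
  by apply: ms'; rewrite inE eqxx.
have Hs' : s' = h :: behead s'.
  by move: E; rewrite /s' /s; case: (s1) => [|? ?] [->].
have [a [b good]] : exists a b, good_colouring s' a b.
  rewrite Hs'; apply: IH.
  - have := perm_size ps; rewrite size_cat Hs' /= addSn => -[]; natlia.
  - rewrite -/(sorted ltn (h :: behead s')) -Hs'.
    apply: subseq_sorted ss => //; rewrite E; apply: cat_subseq => //=.
    by rewrite eqxx; exact: suffix_subseq.
  - by rewrite -/(sorted e (h :: behead s')) -Hs'.
  - by rewrite size_behead /s' size_cat /=; natlia.
  have lE : last h t = last y s2.
    by rewrite -[LHS]/(last 0 s) E last_cat /= last_cat.
  by rewrite -[last h _]/(last 0 (h :: behead s')) -Hs' /s' last_cat /= -lE.
(* An edge from [m] to a vertex beyond x or y would cross the chord xy, and the leaf property leaves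
   only the path edges inside. *)
have nbr : {in m, forall v u : nat, u \in s' ++ m -> e v u -> consecutive P v u}.
  move=> v vm u; rewrite -Es => us0 vu.
  have vP : v \in P by rewrite inE mem_rcons inE vm !orbT.
  have xv := xm v vm; have vy := my' v vm; rewrite /= in xv.
  have xu : x <= u.
    by rewrite leqNgt; apply/negP => ux; apply: (nc u x v y) => //; rewrite 1?esym //; natlia.
  have uy : u <= y.
    by rewrite leqNgt; apply/negP => yu; apply: (nc x v y u) => //; natlia.
  have uP' : u \in P.
    move: us0; rewrite E inE mem_rcons inE !(mem_cat, inE).
    by case/or3P => [/s1x|->//|/or3P[->|->|/ys2 /=]]; rewrite ?orbT //; natlia.
  have [uv|uv|uv] := ltngtP u v.
  - have [i iP h'] : consecutive P u v.
      by apply: (leaf_consecutive lf); rewrite 1?esym //; natlia.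
    by exists i => //; case: h'; [right|left].
  - by apply: (leaf_consecutive lf) => //; natlia.
  - by rewrite uv eirr in vu.
have [a' [b' good']] : exists a' b', good_colouring (s' ++ m) a' b'.
  case: few => few; first by apply: (extend_colouring good xs' ys') => //; exact: few.
  (* When y is the end of small degree, the path is read backwards. *)
  have revP : y :: rcons (rev m) x = rev P by rewrite /P rev_cons rev_rcons.
  have [a' [b' g]] : exists a' b', good_colouring (s' ++ rev m) a' b'.
    apply: (extend_colouring good ys' xs'); rewrite ?size_rev ?revP ?rev_uniq 1?esym //.
    - by move=> v; rewrite mem_rev; exact: ms'.
    - move=> v; rewrite mem_rev => vm u uS vu; apply: consecutive_rev; apply: nbr => //.
      by move: uS; rewrite !mem_cat mem_rev.
    - exact: few.
  exists a', b'; apply: good_colouring_sub g => v; by rewrite !mem_cat mem_rev.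
exists a', b'; apply: good_colouring_sub good' => v; by rewrite -Es E.
Qed.

End OrderedGraph.

(** * Hamiltonian cycles and noncrossing chords without K_{2,3} minors *)

Section Hamiltonian.
Variable G : sgraph.
Implicit Types (u v w p q : G) (s t : seq G) (S : {set G}).

(** The branch sets of the two vertices of degree three are single vertices, as in a subdivision. *)
Definition K23_minor_free := forall p q (M : nat -> {set G}), p != q ->
  (forall j, j < 3 -> [/\ connected_in (M j), p \notin M j, q \notin M j,
     exists2 w, w \in M j & adj p w & exists2 w, w \in M j & adj q w]) ->
  ~ (forall j l, j < 3 -> l < 3 -> j != l -> forall v, v \in M j -> v \notin M l).

Lemma path_restrict (r : rel G) S x t : subrel r (@adj G) -> path r x t ->
  {subset x :: t <= S} -> path [rel a b | [&& adj a b, a \in S & b \in S]] x t.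
Proof.
move=> radj; elim: t x => [|y t IH] x //= /andP[/radj xy pt] sub.
rewrite xy !sub ?inE ?eqxx ?orbT //=; apply: IH => // z zt; apply: sub.
by rewrite inE zt orbT.
Qed.

Lemma restrict_sym S : symmetric [rel a b : G | [&& adj a b, a \in S & b \in S]].
Proof. by move=> a b /=; rewrite adj_sym; congr andb; rewrite andbC. Qed.

Lemma connected_in_from S x : (forall v, v \in S ->
    connect [rel a b : G | [&& adj a b, a \in S & b \in S]] x v) -> connected_in S.
Proof.
move=> h u v uS vS; apply: connect_trans (h v vS).
by rewrite (sym_connect_sym (@restrict_sym S)); exact: h.
Qed.

Lemma connected_in_path x t : path (@adj G) x t -> connected_in [set v in x :: t].
Proof.
move=> pt; apply: (@connected_in_from _ x) => v; rewrite inE.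
apply: path_connect; apply: (@path_restrict (@adj G)) => // z zt.
by rewrite inE.
Qed.

Lemma ucycleP s : reflect (cycle (@adj G) s /\ uniq s) (ucycleb (@adj G) s).
Proof. exact: andP. Qed.

(** The two arcs of the cycle between p and q and the set K outside it are the three branch sets; K
    is the default value of [nth]. *)
Lemma K23_theta p q s1 s2 (K : {set G}) : K23_minor_free ->
  cycle (@adj G) (p :: s1 ++ q :: s2) -> uniq (p :: s1 ++ q :: s2) ->
  s1 != [::] -> s2 != [::] -> connected_in K ->
  {in K, forall v, v \notin p :: s1 ++ q :: s2} ->
  (exists2 w, w \in K & adj p w) -> (exists2 w, w \in K & adj q w) -> False.
Proof.
move=> free; case: s1 => // x1 s1; case: s2 => // x2 s2.
rewrite /= rcons_cat cat_path /= rcons_path.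
move=> /and5P[px1 ps1 ls1q qx2 /andP[ps2 ls2p]] /and3P[pn x1n un] _ _ cK Ks pK qK.
have := un; rewrite cat_uniq /= => /and3P[us1 /norP[qs1 /norP[x2s1 /hasPn s2s1]] /and3P[qn x2n us2]].
have pq : p != q by move: pn; rewrite !(mem_cat, inE) !negb_or; case/and4P.
have pn1 : p \notin x1 :: s1.
  by move: pn; rewrite !(mem_cat, inE) !negb_or => /and5P[-> -> _ _ _].
have pn2 : p \notin x2 :: s2.
  by move: pn; rewrite !(mem_cat, inE) !negb_or => /and5P[_ _ _ -> ->].
have qn1 : q \notin x1 :: s1.
  move: x1n; rewrite !(mem_cat, inE) !negb_or => /and3P[_ h _].
  by rewrite eq_sym h.
have d12 v : v \in x1 :: s1 -> v \notin x2 :: s2.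
  rewrite !inE => /orP[/eqP ->|v1].
    by move: x1n; rewrite !(mem_cat, inE) !negb_or => /and3P[_ _].
  rewrite negb_or; apply/andP; split; first by apply: contra x2s1 => /eqP <-.
  by apply/negP => /s2s1; rewrite v1.
have Kn v (vK : v \in K) := Ks v vK.
pose M j := nth K [:: [set v in x1 :: s1]; [set v in x2 :: s2]] j.
apply: (free p q M pq).
- case=> [|[|[|//]]] _; rewrite /M /=.
  + split; rewrite ?inE //; first exact: connected_in_path.
      by exists x1; rewrite ?inE ?eqxx.
    by exists (last x1 s1); [rewrite inE mem_last|rewrite adj_sym].
  + split; rewrite ?inE //; first exact: connected_in_path.
      by exists (last x2 s2); [rewrite inE mem_last|rewrite adj_sym].
    by exists x2; rewrite ?inE ?eqxx.
  + split=> //; apply/negP => /Kn; rewrite !(mem_cat, inE) ?eqxx ?orbT //.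
have sym (A B : {set G}) : (forall v, v \in A -> v \notin B) ->
    forall v, v \in B -> v \notin A.
  by move=> h v vB; apply/negP => /h; rewrite vB.
have D01 v : v \in [set v in x1 :: s1] -> v \notin [set v in x2 :: s2].
  by rewrite inE => /d12; rewrite inE.
have D02 v : v \in K -> v \notin [set v in x1 :: s1].
  move=> /Kn; apply: contra; rewrite !(inE, mem_cat).
  by case/orP => ->; rewrite ?orbT.
have D12 v : v \in K -> v \notin [set v in x2 :: s2].
  move=> /Kn; apply: contra; rewrite !(inE, mem_cat).
  by case/orP => ->; rewrite ?orbT.
by case=> [|[|[|//]]] [|[|[|//]]] // _ _ _; rewrite /M /=; apply: sym.
Qed.

(** The edge pq of the cycle is replaced by a detour along a simple path of K from [wp] to [wq]. *)
Lemma insert_in_cycle p q s2 (K : {set G}) wp wq :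
  cycle (@adj G) (p :: q :: s2) -> uniq (p :: q :: s2) -> connected_in K ->
  {in K, forall v, v \notin p :: q :: s2} ->
  wp \in K -> wq \in K -> adj p wp -> adj q wq ->
  exists2 s' : seq G, is_cycle s' & size (p :: q :: s2) < size s'.
Proof.
move=> cy un cK Ks wpK wqK pwp qwq.
have /connectP[t0 pt0 lt0] := cK wp wq wpK wqK.
case: (shortenP pt0) lt0 => t pt ut _ lt {t0 pt0}.
have tK v : v \in wp :: t -> v \in K.
  rewrite inE => /orP[/eqP ->//|]; elim: t (wp) pt {ut lt} => [|y t IH] x //=.
  by case/andP => /and3P[_ _ yK] py; rewrite inE => /orP[/eqP ->//|]; exact: IH py.
have pta : path (@adj G) wp t by apply: sub_path pt => a b /= /and3P[].
exists (p :: (wp :: t) ++ q :: s2); last by rewrite /= size_cat /=; natlia.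
rewrite /is_cycle /ucycleb; apply/and3P; split.
- by rewrite /= size_cat /=; natlia.
- move: cy => /= /andP[_ pc].
  rewrite rcons_cat cat_path pwp pta /= -lt adj_sym qwq /=.
  exact: pc.
- rewrite -[p :: _]/([:: p] ++ _) -(perm_uniq (_ : perm_eq ((wp :: t) ++ p :: q :: s2) _)); last first.
    by rewrite perm_sym perm_catCA.
  rewrite cat_uniq ut un andbT; apply/hasPn => v vs; apply/negP => /tK /Ks.
  by rewrite vs.
Qed.

Lemma split_cycle s p q : cycle (@adj G) s -> uniq s -> p \in s -> q \in s -> p != q ->
  exists s1 s2, [/\ cycle (@adj G) (p :: s1 ++ q :: s2), uniq (p :: s1 ++ q :: s2),
    p :: s1 ++ q :: s2 =i s & size (p :: s1 ++ q :: s2) = size s].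
Proof.
move=> cs us ps qs pq; case: (rot_to ps) => i s' E.
have qs' : q \in s'.
  have : q \in p :: s' by rewrite -E mem_rot.
  by rewrite inE eq_sym (negbTE pq).
case/splitPr: qs' E => s1 s2 E; exists s1, s2; rewrite -E.
by split; [rewrite rot_cycle|rewrite rot_uniq|move=> v; rewrite mem_rot|rewrite size_rot].
Qed.

(** For a vertex v off the cycle, its component [K] off the cycle has two attachments p and q by
    2-connectedness. If these are neighbours on the cycle, a detour through [K] gives a longer
    cycle; otherwise [K23_theta] applies. *)
Lemma longest_cycle_hamiltonian s : k_connected G 2 -> K23_minor_free -> is_cycle s ->
  (forall s' : seq G, is_cycle s' -> size s' <= size s) -> forall v : G, v \in s.
Proof.
move=> [_ conn] free /andP[s3 /ucycleP[cs us]] smax v; apply: contrapT => /negP vs.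
pose r := [rel a b : G | [&& adj a b, a \notin s & b \notin s]].
pose K := [set w | connect r v w].
have Ks w : w \in K -> w \notin s.
  rewrite inE => /connectP[t pt ->]; elim: t (v) vs pt => [|y t IH] x xs //=.
  by case/andP => /and3P[_ _ ys]; exact: IH.
have Kstep w z : w \in K -> adj w z -> z \notin s -> z \in K.
  move=> wK wz zs; have ws := Ks w wK; move: wK; rewrite !inE => h.
  by apply: connect_trans h _; apply: connect1; rewrite /r /= wz ws.
have cK : connected_in K.
  apply: (@connected_in_from _ v) => w; rewrite inE => /connectP[t pt ->].
  apply/connectP; exists t => //; apply: (@path_restrict r) => //.
    by move=> a b /and3P[].
  by move=> z zt; rewrite inE; exact: path_connect zt.
pose A := [set p in s | [exists w in K, adj p w]].
have : 1 < #|A|.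
  (* With at most one attachment, [A] would separate v from the rest of the cycle. *)
  rewrite ltnNge; apply/negP => A1.
  have [z zs zA] : exists2 z, z \in s & z \notin A.
    apply: contrapT => h; have : size s <= #|A|.
      rewrite -(card_uniqP us); apply/subset_leq_card/fintype.subsetP => z zs.
      by apply: contrapT => /negP zA; apply: h; exists z.
    by natlia.
  have vA : v \notin A by rewrite inE (negbTE vs).
  have /connectP[t pt E] := conn A A1 v z vA zA.
  suff : z \in K by move/Ks; rewrite zs.
  have : v \in K by rewrite inE connect0.
  rewrite E; elim: t (v) pt {E vs vA} => [|y t IH] x //= /andP[/and3P[xy xA yA] pt] xK.
  apply: IH pt _; apply: (Kstep x) => //; apply: contra yA => ys.
  by rewrite inE ys /=; apply/existsP; exists x; rewrite xK adj_sym.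
case/card_gt1P => p [q []]; rewrite !inE => /andP[ps /existsP[wp /andP[wpK pwp]]].
move=> /andP[qs /existsP[wq /andP[wqK qwq]]] pq.
have [s1 [s2 [cs' us' Es sz]]] := split_cycle cs us ps qs pq.
have KE w : w \in K -> w \notin p :: s1 ++ q :: s2 by rewrite Es; exact: Ks.
case: s1 => [|x1 s1] in cs' us' Es sz KE.
  have [s' /smax] := insert_in_cycle cs' us' cK KE wpK wqK pwp qwq.
  by rewrite -sz ltnNge => ->.
case: s2 => [|x2 s2] in cs' us' Es sz KE.
  (* Here q precedes p on the cycle, which is rotated so that the detour starts at q. *)
  have E : rot (size (p :: x1 :: s1)) (p :: (x1 :: s1) ++ [:: q]) = q :: p :: x1 :: s1.
    by rewrite -cat_cons rot_size_cat.
  have cs2 : cycle (@adj G) (q :: p :: x1 :: s1) by rewrite -E rot_cycle.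
  have us2 : uniq (q :: p :: x1 :: s1) by rewrite -E rot_uniq.
  have KE2 w : w \in K -> w \notin q :: p :: x1 :: s1 by rewrite -E mem_rot; exact: KE.
  have [s' /smax] := insert_in_cycle cs2 us2 cK KE2 wqK wpK qwq pwp.
  by rewrite -E size_rot sz ltnNge => ->.
by apply: (K23_theta free cs' us' _ _ cK KE); [| |exists wp|exists wq].
Qed.

Lemma K23_arcs p q x0 t0 x1 t1 x2 t2 : K23_minor_free ->
  uniq (p :: q :: (x0 :: t0) ++ (x1 :: t1) ++ x2 :: t2) ->
  path (@adj G) x0 t0 -> path (@adj G) x1 t1 -> path (@adj G) x2 t2 ->
  (exists2 w, w \in x0 :: t0 & adj p w) -> (exists2 w, w \in x0 :: t0 & adj q w) ->
  (exists2 w, w \in x1 :: t1 & adj p w) -> (exists2 w, w \in x1 :: t1 & adj q w) ->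
  (exists2 w, w \in x2 :: t2 & adj p w) -> (exists2 w, w \in x2 :: t2 & adj q w) ->
  False.
Proof.
move=> free; set L0 := x0 :: t0; set L1 := x1 :: t1; set L2 := x2 :: t2.
have notin (v : G) (A B C : seq G) : v \notin A ++ B ++ C -> [/\ v \notin A, v \notin B & v \notin C].
  by rewrite !mem_cat !negb_or => /and3P.
rewrite 2!cons_uniq in_cons negb_or.
move=> /and3P[/andP[pq /notin[p0 p1 p2]] /notin[q0 q1 q2]].
rewrite !cat_uniq has_cat negb_or.
move=> /and3P[_ /andP[/hasPn d01 /hasPn d02] /and3P[_ /hasPn d12 _]].
move=> P0 P1 P2 [w0 w0L a0] [z0 z0L b0] [w1 w1L a1] [z1 z1L b1] [w2 w2L a2] [z2 z2L b2].
pose M j := [set v in nth L2 [:: L0; L1] j].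
apply: (free p q M pq).
- case=> [|[|[|//]]] _; rewrite /M /=; split; rewrite ?finset.in_set //;
    try exact: connected_in_path.
  + by exists w0; rewrite // finset.in_set.
  + by exists z0; rewrite // finset.in_set.
  + by exists w1; rewrite // finset.in_set.
  + by exists z1; rewrite // finset.in_set.
  + by exists w2; rewrite // finset.in_set.
  + by exists z2; rewrite // finset.in_set.
have sym (A B : seq G) : (forall v, v \in A -> v \notin B) ->
    forall v, v \in B -> v \notin A.
  by move=> h v vB; apply/negP => /h; rewrite vB.
case=> [|[|[|//]]] [|[|[|//]]] // _ _ _ v; rewrite /M /= !finset.in_set; move: v.
- exact: sym.
- exact: sym.
- exact: d01.
- exact: sym.
- exact: d02.
- exact: d12.
Qed.

(** The two vertices of degree three are a and b. The branch sets are the arc [s1], the arc after b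
    up to c, which a sees along ac, and the rest of the cycle back to a, which b sees along bd. *)
Lemma K23_crossing a b c d s1 s2 s3 s4 : K23_minor_free ->
  cycle (@adj G) (a :: s1 ++ b :: s2 ++ c :: s3 ++ d :: s4) ->
  uniq (a :: s1 ++ b :: s2 ++ c :: s3 ++ d :: s4) ->
  adj a c -> adj b d -> s1 != [::] -> False.
Proof.
move=> free; case: s1 => // x1 s1 cy un ac bd _.
move: cy; rewrite /= rcons_cat cat_path /= rcons_cat cat_path /= rcons_cat cat_path /=.
move=> /and5P[ax1 p1 l1b p2 /and3P[l2c p3 /andP[l3d p4]]].
move: p4; rewrite rcons_path => /andP[p4 l4a].
have [x2 [t2 [E2 l2 P2 bx2]]] : exists x2 t2,
    [/\ rcons s2 c = x2 :: t2, last x2 t2 = c, path (@adj G) x2 t2 & adj b x2].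
  case: s2 p2 l2c {un} => [|y s2] /= p2 l2c; first by exists c, [::].
  exists y, (rcons s2 c); rewrite last_rcons rcons_path l2c andbT.
  by case/andP: p2.
have [x3 [t3 [E3 l3 P3]]] : exists x3 t3,
    [/\ s3 ++ d :: s4 = x3 :: t3, last x3 t3 = last d s4 & path (@adj G) x3 t3].
  case: s3 p3 l3d {un} => [|y s3] /= p3 l3d; first by exists d, s4.
  exists y, (s3 ++ d :: s4); rewrite last_cat /= cat_path /= l3d p4 !andbT.
  by case/andP: p3.
apply: (@K23_arcs a b x1 s1 x2 t2 x3 t3 free) => //.
- have pe : perm_eq (a :: (x1 :: s1) ++ b :: s2 ++ c :: s3 ++ d :: s4)
      (a :: b :: (x1 :: s1) ++ (x2 :: t2) ++ x3 :: t3).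
    rewrite -E2 -E3 perm_cons -cats1 -!catA cat1s.
    by rewrite -[b :: s2 ++ _]cat1s perm_catCA.
  by rewrite -(perm_uniq pe).
- by exists x1; rewrite ?mem_head.
- by exists (last x1 s1); [exact: mem_last|rewrite adj_sym].
- by exists c => //; rewrite -l2 mem_last.
- by exists x2; rewrite ?mem_head.
- by exists (last d s4); [rewrite -l3 mem_last|rewrite adj_sym].
- by exists d => //; rewrite -E3 mem_cat inE eqxx orbT.
Qed.

(** The minor needs a vertex between two consecutive ends, as K_4 shows. If [s1] and [s2] are both
    empty, a, b, c form a triangle; otherwise [K23_crossing] applies, after a rotation if
    necessary. *)
Lemma no_crossing_chords a b c d s1 s2 s3 s4 : K23_minor_free ->
  (forall u v w : G, adj u v -> adj v w -> adj u w -> False) ->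
  cycle (@adj G) (a :: s1 ++ b :: s2 ++ c :: s3 ++ d :: s4) ->
  uniq (a :: s1 ++ b :: s2 ++ c :: s3 ++ d :: s4) ->
  adj a c -> adj b d -> False.
Proof.
move=> free tf cy un ac bd.
have [s10|] := eqVneq s1 [::]; last exact: (K23_crossing free cy un ac bd).
have [s20|s2n] := eqVneq s2 [::].
  move: cy; rewrite s10 s20 /= => /and3P[ab bc _].
  exact: (tf a b c).
have E : rot (size (a :: s1)) (a :: s1 ++ b :: s2 ++ c :: s3 ++ d :: s4) =
    b :: s2 ++ c :: s3 ++ d :: s4 ++ a :: s1.
  by rewrite -cat_cons rot_size_cat /= -!catA /= -!catA.
apply: (@K23_crossing b c d a s2 s3 s4 s1 free) => //; rewrite -?E ?rot_cycle ?rot_uniq //.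
by rewrite adj_sym.
Qed.

Lemma drop_split (x0 : G) s i j : i < j -> i < size s ->
  drop i s = nth x0 s i :: take (j - i.+1) (drop i.+1 s) ++ drop j s.
Proof.
move=> ij si; rewrite (drop_nth x0) //; congr (_ :: _).
by rewrite -{1}(cat_take_drop (j - i.+1) (drop i.+1 s)) drop_drop subnK.
Qed.

(** The bounds keep positions past the end from inheriting the edges of the default vertex [x0]. *)
Definition position_rel (x0 : G) s : rel nat :=
  [rel i j | [&& i < size s, j < size s & adj (nth x0 s i) (nth x0 s j)]].

Lemma position_noncrossing x0 s : K23_minor_free ->
  (forall u v w : G, adj u v -> adj v w -> adj u w -> False) ->
  cycle (@adj G) s -> uniq s -> noncrossing (position_rel x0 s).
Proof.
move=> free tf cy un i j l p /andP[ij jl] lp /and3P[_ _ ail] /and3P[_ ps ajp].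
have ls := ltn_trans lp ps; have js := ltn_trans jl ls; have is_ := ltn_trans ij js.
have := rot_uniq i s; have := rot_cycle i (@adj G) s; rewrite cy un /rot.
rewrite (drop_split x0 ij is_) (drop_split x0 jl js) (drop_split x0 lp ls).
rewrite (drop_nth x0 ps) /= -!catA /= -!catA /= -!catA /= => cy' un'.
apply: (no_crossing_chords free tf _ _ ail ajp); first exact: cy'.
exact: un'.
Qed.

Lemma position_degree x0 s (v : nat) (u : seq nat) : uniq s -> uniq u ->
  count (position_rel x0 s v) u <= max_degree G.
Proof.
move=> us uu; rewrite -size_filter.
set f := seq.filter _ u.
have fP i : i \in f -> i < size s /\ adj (nth x0 s v) (nth x0 s i).
  by rewrite mem_filter => /andP[/and3P[]].
rewrite -(size_map (nth x0 s)).
have umap : uniq (map (nth x0 s) f).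
  rewrite map_inj_in_uniq ?filter_uniq // => i j /fP[si _] /fP[sj _] /eqP.
  by rewrite nth_uniq // => /eqP.
rewrite -(card_uniqP umap).
apply: leq_trans (leq_bigmax (nth x0 s v)).
apply/subset_leq_card/fintype.subsetP => z /mapP[i /fP[_ h] ->].
by rewrite inE.
Qed.

(** The Hamiltonian cycle numbers the vertices, and [ordered_colouring] is transported along
    [index]. Its condition of more than 6 colours holds because Delta + 2 is at least 7. *)
Lemma square_colouring s : 4 < max_degree G -> K23_minor_free ->
  (forall u v w : G, adj u v -> adj v w -> adj u w -> False) ->
  cycle (@adj G) s -> uniq s -> (forall v, v \in s) ->
  exists a b : G -> 'I_(max_degree G + 2),
  [/\ forall u v, adj u v -> [/\ a u != a v, b u != b v & a u != b v],
      forall u, a u != b u &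
      forall u v w, u != w -> adj u v -> adj v w -> b u != b w].
Proof.
move=> D4 free tf cy us all_s; set D := max_degree G in D4 *.
case: s => [|x0 t] in cy us all_s.
  have : max_degree G <= 0 by apply/bigmax_leqP => v; have := all_s v.
  by rewrite -/D; natlia.
set s := x0 :: t in us all_s.
pose e := position_rel x0 s.
have esym : symmetric e by move=> i j; rewrite /e /position_rel /= adj_sym andbCA.
have eirr : irreflexive e by move=> i; rewrite /e /position_rel /= adj_irrefl !andbF.
have enc : noncrossing e by exact: position_noncrossing.
have etf : triangle_free e.
  by move=> i j l /and3P[_ _ h1] /and3P[_ _ h2] /and3P[_ _ h3]; exact: tf h1 h2 h3.
have edeg (v : nat) (u : seq nat) : uniq u -> count (e v) u <= D by exact: position_degree.
have t0 : 0 < size t.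
  rewrite lt0n size_eq0; apply/eqP => t0.
  have : max_degree G <= 0.
    apply/bigmax_leqP => v _; rewrite leqn0 cards_eq0; apply/eqP/setP => w.
    rewrite !inE; have := all_s v; have := all_s w; rewrite /s t0 !inE.
    by move=> /eqP -> /eqP ->; rewrite adj_irrefl.
  by rewrite -/D; natlia.
have es i : i < size t -> e i i.+1.
  move=> it; rewrite /e /position_rel /= !ltnS it (ltnW it) /=.
  have := cy; rewrite /= rcons_path => /andP[/(pathP x0) h _].
  exact: h.
have p1 : path ltn 0 (iota 1 (size t)) := iota_ltn_sorted 0 (size t).+1.
have nthi i : i <= size t -> nth 0 (0 :: iota 1 (size t)) i = i.
  by move=> it; rewrite -[0 :: _]/(iota 0 (size t).+1) nth_iota.
have p2 : path e 0 (iota 1 (size t)).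
  apply/(pathP 0) => i; rewrite size_iota => it.
  by rewrite nthi ?(ltnW it) // nth_iota // add1n; exact: es.
have p3 : e 0 (last 0 (iota 1 (size t))).
  rewrite (last_nth 0) size_iota nthi // /e /position_rel /= ltnSn /= -last_nth adj_sym.
  by move: cy; rewrite /= rcons_path => /andP[].
have [a [b [g1 g2 g3]]] : exists a b, good_colouring (k := D + 2) e (0 :: iota 1 (size t)) a b.
  apply: (@ordered_colouring (D + 2) D) => //; rewrite ?size_iota //; natlia.
have im v : index v s \in 0 :: iota 1 (size t).
  by rewrite -[0 :: _]/(iota 0 (size s)) mem_iota leq0n add0n index_mem all_s.
have ei u v : adj u v -> e (index u s) (index v s).
  by move=> uv; apply/and3P; rewrite !index_mem !nth_index.
exists (fun v => a (index v s)), (fun v => b (index v s)); split.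
- by move=> u v uv; apply: g1 => //; exact: ei.
- by move=> u; exact: g2.
- move=> u v w uw uv vw; apply: (g3 _ (index v s)) => //; try exact: ei.
  apply: contra uw => /eqP E; apply/eqP.
  by rewrite -(nth_index x0 (all_s u)) -(nth_index x0 (all_s w)) E.
Qed.
End Hamiltonian.

(** * Incidences, walks in G^{1/3}, and the lower bound *)

Section Incidences.
Variable G : sgraph.
Implicit Types (u v w : G) (i j : incidence G).

Definition src i : G := (val i).1.

(** The far end of the edge; by [oth_spec] the default [src i] is never taken. *)
Definition oth i : G := odflt (src i) [pick w in (val i).2 :\ src i].

Lemma oth_spec i : adj (src i) (oth i) /\ (val i).2 = [set src i; oth i].
Proof.
have /andP[/imsetP[[p q]]] := valP i; rewrite inE /= -/(src i) => pq E.
have np : p != q by apply/eqP => Epq; rewrite Epq adj_irrefl in pq.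
have key x y : x != y -> adj x y -> (val i).2 = [set x; y] -> src i = x ->
    adj (src i) (oth i) /\ (val i).2 = [set src i; oth i].
  move=> xy axy Exy sx; suff -> : oth i = y by rewrite sx.
  rewrite /oth sx Exy; case: pickP => [w|/(_ y)] /=; rewrite !inE.
    by case/andP => /negbTE -> /eqP.
  by rewrite eqxx orbT eq_sym xy.
rewrite E !inE => /orP[] /eqP sE.
  by rewrite -E; exact: (key p q).
rewrite -E; apply: (key q p) => //; first by rewrite eq_sym.
  by rewrite adj_sym.
by rewrite E finset.setUC.
Qed.

Lemma oth_adj i : adj (src i) (oth i). Proof. by case: (oth_spec i). Qed.

Lemma src_neq_oth i : src i != oth i.
Proof. by apply/eqP => E; have := oth_adj i; rewrite -E adj_irrefl. Qed.

Lemma incidence_ext i j : src i = src j -> oth i = oth j -> i = j.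
Proof.
move=> E1 E2; apply: val_inj.
have [_ Ei] := oth_spec i; have [_ Ej] := oth_spec j.
by rewrite (surjective_pairing (val i)) (surjective_pairing (val j)) Ei Ej E1 E2
  -/(src i) -/(src j) E1.
Qed.

Lemma adj_third_vi u i : adj_third (inl u) (inr i) -> u = src i.
Proof. by move/eqP. Qed.

Lemma adj_third_iv u i : adj_third (inr i) (inl u) -> u = src i.
Proof. by move/eqP. Qed.

Lemma adj_third_ii i j : adj_third (inr i) (inr j) -> src j = oth i /\ oth j = src i.
Proof.
case/andP => /eqP E ne; have [_ Ei] := oth_spec i; have [_ Ej] := oth_spec j.
rewrite -/(src i) -/(src j) in ne.
have sj : src j = oth i.
  have : src j \in (val i).2 by rewrite E Ej !inE eqxx.
  by rewrite Ei !inE eq_sym (negbTE ne) => /eqP.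
split=> //; have : oth j \in (val i).2 by rewrite E Ej !inE eqxx orbT.
by rewrite Ei !inE -sj [oth j == src j]eq_sym (negbTE (src_neq_oth j)) orbF => /eqP.
Qed.

Lemma mem_I2 v i : i \in I2 v -> oth i = v.
Proof.
rewrite !inE => /andP[av /eqP E]; have [_ Ei] := oth_spec i.
have : oth i \in (val i).2 by rewrite Ei !inE eqxx orbT.
by rewrite E !inE [_ == (val i).1]eq_sym (negbTE (src_neq_oth i)) => /eqP.
Qed.

(* [b v] becomes the common colour of I_2(v). *)
Lemma vi_colouring_of_pair k (a b : G -> 'I_k) :
  (forall u v, adj u v -> [/\ a u != a v, b u != b v & a u != b v]) ->
  (forall u, a u != b u) ->
  (forall u v w, u != w -> adj u v -> adj v w -> b u != b w) ->
  exists c : vi_elt G -> 'I_k, vi_ks_coloring 1 c.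
Proof.
move=> h1 h2 h3.
pose c (x : vi_elt G) := match x with inl u => a u | inr i => b (oth i) end.
have aa i : a (src i) != a (oth i) by case: (h1 _ _ (oth_adj i)).
have bb i : b (src i) != b (oth i) by case: (h1 _ _ (oth_adj i)).
have ab i : a (src i) != b (oth i) by case: (h1 _ _ (oth_adj i)).
exists c; split; last first.
  move=> v; rewrite -(cards1 (b v)); apply/subset_leq_card/fintype.subsetP => z.
  by case/imsetP => i /mem_I2 E ->; rewrite /= E inE.
move=> x y xy [p [pp lp sp]].
have a2b i : a (oth i) != b (oth i) by exact: h2.
have sab i : a (src i) != b (src i) by exact: h2.
(* All walks of length at most 3 are sorted by the kind of each of their points. Only two incidences
   at the same source call for colours that differ at distance two in G. *)
case: p sp pp lp => [|z1 [|z2 [|z3 [|//]]]] _ /=.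
- by move=> _ E; rewrite E eqxx in xy.
- rewrite andbT => s1 E; subst z1; case: x s1 xy => [u|i]; case: y => [u1|i1] //.
  + by move/adj_third_vi => -> _; exact: ab.
  + by move/adj_third_iv => -> _; rewrite eq_sym; exact: ab.
  + by move/adj_third_ii => [_ E2] _; rewrite /= E2 eq_sym; exact: bb.
- rewrite andbT => /andP[s1 s2] E; subst z2.
  case: x s1 xy => [u|i]; case: z1 s2 => [u1|i1]; case: y => [u2|i2] //.
  + by move/adj_third_iv => -> /adj_third_vi -> /eqP.
  + by move/adj_third_ii => [_ E2] /adj_third_vi -> _; rewrite /= E2; exact: sab.
  + move/adj_third_vi => E2 /adj_third_iv E1 xy; apply: (h3 _ (src i)).
    * apply: contra xy => /eqP E; apply/eqP; congr inr; apply: incidence_ext => //.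
      by rewrite -E1.
    * by rewrite adj_sym; exact: oth_adj.
    * by rewrite -E1 E2; exact: oth_adj.
  + by move/adj_third_iv => -> /adj_third_ii[-> _] _; rewrite eq_sym; exact: a2b.
  + move/adj_third_ii => [E1 E2] /adj_third_ii[E3 E4] /eqP[].
    by congr inr; apply: incidence_ext; rewrite ?E1 ?E2.
- rewrite andbT => /and3P[s1 s2 s3] E; subst z3.
  case: x s1 xy => [u|i]; case: z1 s2 => [u1|i1]; case: z2 s3 => [u2|i2];
    case: y => [u3|i3] //.
  + by move/adj_third_vi => E3 /adj_third_iv E2 /adj_third_vi -> _;
      rewrite -E2 E3; exact: ab.
  + by move/adj_third_iv => -> /adj_third_ii[-> _] /adj_third_vi -> _; exact: aa.
  + move/adj_third_ii => [_ E3] /adj_third_ii[E2 _] /adj_third_vi -> _.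
    by rewrite /= E3 E2; exact: ab.
  + move/adj_third_iv => -> /adj_third_vi <- /adj_third_iv -> _.
    by rewrite eq_sym; exact: ab.
  + move/adj_third_ii => [_ E3] /adj_third_vi E2 /adj_third_iv E1 _.
    by rewrite /= E3 -E2 E1 eq_sym; exact: bb.
  + move/adj_third_vi => E3 /adj_third_iv E2 /adj_third_ii[E1 _] _.
    by rewrite /= -E1 -E2 E3; exact: bb.
  + move/adj_third_iv => -> /adj_third_ii[-> _] /adj_third_ii[_ ->] _.
    by rewrite eq_sym; exact: ab.
  + move/adj_third_ii => [_ E3] /adj_third_ii[E2 _] /adj_third_ii[_ E1] _.
    by rewrite /= E3 E2 E1 eq_sym; exact: bb.
Qed.

Lemma adj_edge_set u v : adj u v ->
  ([set u; v] \in edges G) && (u \in [set u; v]) && (v \in [set u; v]).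
Proof. by move=> uv; rewrite adj_edge // !inE !eqxx orbT. Qed.

(** At a vertex v of maximum degree, v itself, its Delta incidences and the incidence of one
    neighbour [w0] with the edge v [w0] are pairwise within distance 3. *)
Lemma vi_colouring_lower_bound k (c : vi_elt G -> 'I_k) : 0 < max_degree G ->
  vi_coloring c -> max_degree G + 2 <= k.
Proof.
move=> D0 hc.
have G0 : 0 < #|G|.
  rewrite lt0n; apply/eqP => G0; move: D0; rewrite /max_degree big1 // => v _.
  by have := card0_eq G0 v.
have [v Dv] := bigop.eq_bigmax (fun v : G => #|neighbours v|) G0.
rewrite -/(max_degree G) in Dv.
have /card_gt0P[w0 w0N] : 0 < #|neighbours v| by rewrite -Dv.
have vw0 : adj v w0 by move: w0N; rewrite inE.
have pv w : adj v w -> ((v, [set v; w]).2 \in edges G) && ((v, [set v; w]).1 \in (v, [set v; w]).2).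
  by move/adj_edge_set => /andP[].
have pw : ((w0, [set v; w0]).2 \in edges G) && ((w0, [set v; w0]).1 \in (w0, [set v; w0]).2).
  by have /andP[/andP[-> _] ->] := adj_edge_set vw0.
pose i1 : incidence G := exist _ (w0, [set v; w0]) pw.
(* The default [i1] is taken only for w not adjacent to v. *)
pose g w : incidence G := insubd i1 (v, [set v; w]).
have gE w : adj v w -> val (g w) = (v, [set v; w]).
  by move=> vw; rewrite val_insubd pv.
pose f w : vi_elt G := inr (g w).
have vf w : adj v w -> adj_third (inl v) (f w) by move=> vw; rewrite /= gE.
have fv w : adj v w -> adj_third (f w) (inl v) by move=> vw; rewrite /= gE.
have nvw0 : v != w0 by apply/eqP => E; rewrite E adj_irrefl in vw0.
have fi : adj_third (f w0) (inr i1) by rewrite /= gE //= eqxx.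
have if_ : adj_third (inr i1) (f w0) by rewrite /= gE //= eqxx eq_sym.
pose L : seq (vi_elt G) := inl v :: inr i1 :: [seq f w | w <- enum (neighbours v)].
have Nadj w : w \in enum (neighbours v) -> adj v w by rewrite mem_enum inE.
have uL : uniq L.
  rewrite /L /= inE /= map_inj_in_uniq ?enum_uniq ?andbT.
    apply/andP; split; first by apply/mapP => -[].
    apply/mapP => -[w /Nadj vw [E]]; move: (gE w vw); rewrite -E /= => -[Ev _].
    by rewrite Ev eqxx in nvw0.
  move=> w w' /Nadj vw /Nadj vw' [E].
  have : w \in (val (g w')).2 by rewrite -E gE //= !inE eqxx orbT.
  rewrite gE //= !inE => /orP[/eqP wv|/eqP //].
  by rewrite wv adj_irrefl in vw.
have dL x y : x \in L -> y \in L -> dist_third_le 3 x y.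
  have vx z : z \in L -> exists p, [/\ path (@adj_third G) (inl v) p, last (inl v) p = z & size p <= 2].
    rewrite !inE => /or3P[/eqP ->|/eqP ->|/mapP[w /Nadj vw ->]].
    - by exists [::].
    - by exists [:: f w0; inr i1]; rewrite /path vf // fi.
    - by exists [:: f w]; rewrite /path vf.
  rewrite inE => /orP[/eqP ->|].
    by case/vx => p [pp lp sp]; exists p; split=> //; apply: leq_trans sp _.
  rewrite inE => /orP[/eqP ->|/mapP[w /Nadj vw ->]].
    rewrite !inE => /or3P[/eqP ->|/eqP ->|/mapP[w /Nadj vw ->]].
    - by exists [:: f w0; inl v]; rewrite /path if_ fv.
    - by exists [::].
    - by exists [:: f w0; inl v; f w]; rewrite /path if_ fv // vf.
  case/vx => p [pp lp sp]; exists (inl v :: p); split=> //.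
  by rewrite /path -/(path _ _ _) fv.
have : uniq (map c L).
  rewrite map_inj_in_uniq // => x y xL yL; apply: contra_eq => xy.
  exact: hc (dL x y xL yL).
move=> /card_uniqP; rewrite size_map /= size_map -cardE -Dv => E.
have := max_card (mem (map c L)); rewrite card_ord [#|_|]E; natlia.
Qed.

End Incidences.

(** * Both bounds for 2-connected outerplanar graphs of girth at least 4 *)

Theorem theorem22 (R : realType) (G : sgraph) (Delta g : nat)
  (hconn : k_connected G 2)
  (houter : outerplanar R G)
  (hDelta : max_degree G = Delta) (hDelta5 : 5 <= Delta)
  (hg : is_girth G g) (hg4 : 4 <= g) :
  is_chi_vi G 1 (Delta + 2).
Proof.
subst Delta; split; last first.
  by move=> k [c [hc _]]; apply: vi_colouring_lower_bound hc; natlia.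
have [D [F [[fF _] cF]]] := houter.
have free : K23_minor_free G by move=> p q M; exact: (outer_no_K23 fF cF).
have [[s0 cs0 _] gmin] := hg.
have tf (u v w : G) : adj u v -> adj v w -> adj u w -> False.
  move=> uv vw uw; have ne (x y : G) : adj x y -> x != y.
    by move=> xy; apply/eqP => E; rewrite E adj_irrefl in xy.
  have : is_cycle [:: u; v; w].
    rewrite /is_cycle /ucycleb /= uv vw adj_sym uw /= !inE negb_or.
    by rewrite !ne.
  by move/gmin => /=; natlia.
have [s cs smax] : exists2 s : seq G, is_cycle s &
    forall s' : seq G, is_cycle s' -> size s' <= size s.
  have : exists n, `[< exists2 s : seq G, is_cycle s & size s = n >].
    by exists (size s0); apply/asboolP; exists s0.
  have bound n : `[< exists2 s : seq G, is_cycle s & size s = n >] -> n <= #|G|.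
    move/asboolP => [s /and3P[_ _ us] <-].
    by rewrite -(card_uniqP us); exact: max_card.
  move=> ex; case: (ex_maxnP ex bound) => n /asboolP[s cs sn] nmax; exists s => // s' cs'.
  by rewrite sn; apply: nmax; apply/asboolP; exists s'.
have ham := longest_cycle_hamiltonian hconn free cs smax.
have /and3P[_ cys us] := cs.
have [a [b [h1 h2 h3]]] := square_colouring hDelta5 free tf cys us ham.
exact: vi_colouring_of_pair h1 h2 h3.
Qed.
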